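(* Let $(X,\|\cdot\|_X)$ and $(Y,\|\cdot\|_Y)$ be real Banach spaces and let $f:X\to Y$ be a locally Lipschitz map with a pseudo-Jacobian mapping $Jf$ that is regular at every $x\in X$ and satisfies the strong chain rule condition on $X$. Suppose that for every $y\in Y$ the locally Lipschitz functional $F_y(x)=\|f(x)-y\|_Y$ satisfies the weighted Chang-Palais-Smale condition for some weight $h$. Then $f$ is a norm-coercive, locally bi-Lipschitz homeomorphism from $X$ onto $Y$, and for every $y\in Y$ $$\mathrm{Lip}\,f^{-1}(y)\le\bigl(\mathrm{Reg}\,Jf(f^{-1}(y))\bigr)^{-1}.$$
   Context: Notation: $B(x;r)$ is the open ball of center $x$ and radius $r$; $L(X,Y)$ is the space of bounded linear operators from $X$ to $Y$ with the operator norm; $X^*=L(X,\mathbb R)$; $\mathrm{co}$ is the convex hull and $\overline{\mathrm{co}}$ the closed convex hull (closure in operator norm). Pseudo-Jacobian: for $\phi:X\to\mathbb R$, $\phi'_+(x;v)=\limsup_{t\to0^+}\frac{\phi(x+tv)-\phi(x)}{t}$. For a continuous map $f:X\to Y$, a nonempty set $Jf(x)\subset L(X,Y)$ is a pseudo-Jacobian of $f$ at $x$ if for every $y^*\in Y^*$ and $v\in X$, $(y^*\circ f)'_+(x;v)\le\sup\{\langle y^*,T(v)\rangle: T\in Jf(x)\}$. A pseudo-Jacobian mapping for $f$ on $X$ (also just called a pseudo-Jacobian $Jf$) is a set-valued map $Jf:X\to2^{L(X,Y)}$ such that $Jf(x)$ is a pseudo-Jacobian of $f$ at $x$ for every $x\in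 X$. The same definition with $Y=\mathbb R$ applies to real-valued functions. Write $Jf(A)=\bigcup_{z\in A}Jf(z)$. Clarke subdifferential: for $\phi:X\to\mathbb R$ locally Lipschitz, $\phi^\circ(x;v)=\limsup_{z\to x,\,t\to0^+}\frac{\phi(z+tv)-\phi(z)}{t}$ and $\partial\phi(x)=\{x^*\in X^*: x^*(v)\le\phi^\circ(x;v)\text{ for all }v\in X\}$, a nonempty $w^*$-compact convex set. Strong chain rule condition: for $y\in Y$ let $F_y(x)=\|f(x)-y\|_Y$. For $x\in X$ and $y\ne f(x)$ let $$\Delta F_y(x)=\partial\|\cdot\|_Y(f(x)-y)\circ\overline{\mathrm{co}}(Jf(x))=\{y^*\circ T:\ y^*\in\partial\|\cdot\|_Y(f(x)-y),\ T\in\overline{\mathrm{co}}(Jf(x))\}\subset X^*.$$ $Jf$ satisfies the strong chain rule condition on $X$ if $f$ is locally Lipschitz and, for each $x\in X$ and each $y\neq f(x)$, the set $\Delta F_y(x)$ is $w^*$-closed and convex in $X^*$, is a pseudo-Jacobian of $F_y$ at $x$, and contains the Clarke subdifferential $\partial F_y(x)$. Regularity: for $T\in L(X,Y)$ let $C(T)=\inf_{\|v^*\|_{Y^*}=1}\|T^*v^*\|_{X^*}$ and $C^*(T)=\inf_{\|u\|_X=1}\|Tu\|_Y$. (If $T$ is an isomorphism, $C(T)=C^*(T)=\|T^{-1}\|^{-1}$.) Define $$\mathrm{Sur}\,Jf(x)=\sup_{r>0}\inf\{C(T): T\in\mathrm{co}\,Jf(B(x;r))\},\qquad \mathrm{Inj}\,Jf(x)=\sup_{r>0}\inf\{C^*(T):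 T\in\mathrm{co}\,Jf(B(x;r))\}.$$ $Jf$ is regular at $x_0$ if, for some $r>0$, every $T\in\mathrm{co}\,Jf(B(x_0;r))$ is an isomorphism from $X$ onto $Y$ and $\mathrm{Reg}\,Jf(x_0)>0$, where $\mathrm{Reg}\,Jf(x_0):=\mathrm{Sur}\,Jf(x_0)=\mathrm{Inj}\,Jf(x_0)$ is the regularity index (the two quantities coincide when the operators in $\mathrm{co}\,Jf(B(x_0;r))$ are isomorphisms). Weighted Chang-Palais-Smale condition: a weight is a continuous nondecreasing function $h:[0,\infty)\to[0,\infty)$ with $\int_0^\infty\frac{1}{1+h(\rho)}\,d\rho=\infty$. For a locally Lipschitz $F:X\to\mathbb R$ put $\lambda_F(x)=\min_{w^*\in\partial F(x)}\|w^*\|_{X^*}$. $F$ satisfies the weighted Chang-Palais-Smale condition with respect to $h$ if every sequence $\{x_n\}\subset X$ such that $\{F(x_n)\}$ is bounded and $\lim_{n\to\infty}\lambda_F(x_n)(1+h(\|x_n\|_X))=0$ contains a (norm-)convergent subsequence. Locally Lipschitz: every point has a neighborhood on which the map is Lipschitz. A homeomorphism is locally bi-Lipschitz if every point of its domain has an open neighborhood $V$ on which $f$ is Lipschitz and such that $f(V)$ is open and $(f|_V)^{-1}$ is Lipschitz on $f(V)$. For a map $g$ between Banach spaces, the local Lipschitz constant at $x$ is $\mathrm{Lip}\,g(x)=\inf_{r>0}\sup\left\{\frac{\|g(u)-g(w)\|}{\|u-w\|}: u,w\in B(x;r),\ u\ne w\right\}$. Norm-coercive: $\lim_{\|x\|_X\to\infty}\|f(x)\|_Y=\infty$.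 *)

(* Defs.v *)
From HB Require Import structures.
From mathcomp Require Import all_boot all_order all_algebra.
From mathcomp Require Import all_classical all_reals all_analysis.

Set Implicit Arguments.
Unset Strict Implicit.
Unset Printing Implicit Defensive.

Import Order.TTheory GRing.Theory Num.Theory.
Import numFieldNormedType.Exports.

Local Open Scope classical_set_scope.
Local Open Scope ring_scope.

Section bounded_operators.
Context {R : realType}.
Implicit Types X Y : normedModType R.

Definition opnorm X Y (T : X -> Y) : \bar R :=
  ereal_sup [set (`|T u|)%:E | u in [set u | `|u| <= 1]].

(* L(X, Y) is encoded as a subset of the function space X -> Y, from which it
   takes its vector space structure. *)
Definition Lop X Y : set (X -> Y) :=
  [set T | linear T /\ (opnorm T < +oo)%E].

Definition dual X : set (X -> R^o) := @Lop X R^o.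

(* T* v* is v* \o T. The infima are taken in \bar R, so that they are +oo when
   the unit sphere is empty (zero space). *)
Definition surj_modulus X Y (T : X -> Y) : \bar R :=
  ereal_inf [set opnorm ((v \o T) : X -> R^o)
            | v in [set v | @dual Y v /\ opnorm v = 1%E]].

Definition inj_modulus X Y (T : X -> Y) : \bar R :=
  ereal_inf [set (`|T u|)%:E | u in [set u | `|u| = 1]].

Definition isomorphism X Y (T : X -> Y) : Prop :=
  Lop T /\ exists S : Y -> X, [/\ Lop S, cancel T S & cancel S T].

Definition conv_hull X Y (A : set (X -> Y)) : set (X -> Y) :=
  smallest (@convex_set R (X -> Y)) A.

(* Closure of the convex hull in L(X, Y) for the operator norm. *)
Definition closed_conv_hull X Y (A : set (X -> Y)) : set (X -> Y) :=
  [set T | Lop T /\ forall e : R, 0 < e ->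
     exists2 S, conv_hull A S & (opnorm ((T - S)%R : X -> Y) < e%:E)%E].

(* The weak-* topology of the dual is the trace of the topology of pointwise
   convergence on X -> R. *)
Definition wstar_closed X (A : set (X -> R^o)) : Prop :=
  A `<=` @dual X /\
  closure (A : set {ptws X -> R^o}) `&` @dual X `<=` A.

End bounded_operators.

Section pseudo_jacobian.
Context {R : realType}.
Implicit Types X Y : normedModType R.

Definition locally_lipschitz X Y (f : X -> Y) : Prop :=
  forall x : X, exists2 V, nbhs x V & [lipschitz f z | z in V].

Definition upper_right_derivative X (phi : X -> R) (x v : X) : \bar R :=
  limf_esup (fun t : R => ((phi (x + t *: v) - phi x) / t)%:E) (0^'+).

(* The image point is f x; the supremum may be +oo, hence \bar R. *)
Definition pseudo_jacobian_at X Y (f : X -> Y) (x : X) (J : set (X -> Y)) :=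
  [/\ continuous f, J !=set0, J `<=` @Lop R X Y &
      forall (y : Y -> R^o) (v : X), dual y ->
        (upper_right_derivative (y \o f) x v
           <= ereal_sup [set (y (T v))%:E | T in J])%E].

Definition pseudo_jacobian X Y (f : X -> Y) (Jf : X -> set (X -> Y)) :=
  forall x, pseudo_jacobian_at f x (Jf x).

Definition clarke_derivative X (phi : X -> R) (x v : X) : \bar R :=
  limf_esup (fun zt : X * R =>
    ((phi (zt.1 + zt.2 *: v) - phi zt.1) / zt.2)%:E)
    (filter_prod (nbhs x) (0^'+)).

Definition clarke_subdiff X (phi : X -> R) (x : X) : set (X -> R^o) :=
  [set w | dual w /\ forall v, ((w v)%:E <= clarke_derivative phi x v)%E].

Definition dist_fun X Y (f : X -> Y) (y : Y) : X -> R^o :=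
  fun x => `|f x - y|.

Definition Delta_dist X Y (f : X -> Y) (Jf : X -> set (X -> Y)) (y : Y)
    (x : X) : set (X -> R^o) :=
  [set (p.1 \o p.2 : X -> R^o) | p in
     clarke_subdiff (fun z : Y => `|z|) (f x - y)
       `*` closed_conv_hull (Jf x)].

Definition strong_chain_rule X Y (f : X -> Y) (Jf : X -> set (X -> Y)) :=
  locally_lipschitz f /\
  forall x y, y != f x ->
    [/\ wstar_closed (Delta_dist f Jf y x),
        @convex_set R (X -> R^o) (Delta_dist f Jf y x),
        pseudo_jacobian_at (dist_fun f y) x (Delta_dist f Jf y x) &
        clarke_subdiff (dist_fun f y) x `<=` Delta_dist f Jf y x].

Definition conv_hull_ball X Y (Jf : X -> set (X -> Y)) (x : X) (r : R) :=
  conv_hull (\bigcup_(z in ball x r) Jf z).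

Definition sur_index X Y (Jf : X -> set (X -> Y)) (x : X) : \bar R :=
  ereal_sup [set ereal_inf (@surj_modulus R X Y @` conv_hull_ball Jf x r)
            | r in [set r : R | 0 < r]].

Definition inj_index X Y (Jf : X -> set (X -> Y)) (x : X) : \bar R :=
  ereal_sup [set ereal_inf (@inj_modulus R X Y @` conv_hull_ball Jf x r)
            | r in [set r : R | 0 < r]].

(* At the points where it is used, all the operators of some conv_hull_ball
   are isomorphisms and this is also inj_index. *)
Definition reg_index X Y (Jf : X -> set (X -> Y)) (x : X) : \bar R :=
  sur_index Jf x.

Definition regular_at X Y (Jf : X -> set (X -> Y)) (x : X) : Prop :=
  (exists2 r : R, 0 < r &
     forall T, conv_hull_ball Jf x r T -> isomorphism T)
  /\ (0 < reg_index Jf x)%E.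

(* Only the values of h on [0, +oo[ matter. *)
Definition weight (h : R -> R) : Prop :=
  [/\ {within `[0, +oo[, continuous h},
      forall s t : R, 0 <= s -> s <= t -> h s <= h t,
      forall t : R, 0 <= t -> 0 <= h t &
      (\int[lebesgue_measure]_(t in `[0%R, +oo[) ((1 + h t)^-1)%:E = +oo)%E].

(* For phi locally Lipschitz, clarke_subdiff phi x is nonempty and weak-*
   compact, so that the infimum is a finite minimum. *)
Definition min_slope X (phi : X -> R) (x : X) : \bar R :=
  ereal_inf (@opnorm R X R^o @` clarke_subdiff phi x).

Definition weighted_chang_PS X (F : X -> R) (h : R -> R) : Prop :=
  forall u : nat -> X,
    (exists M : R, forall n, `|F (u n)| <= M) ->
    (min_slope F (u n) * (1 + h `|u n|)%:E)%E @[n --> \oo] --> 0%E ->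
    exists (k : nat -> nat) (l : X),
      {homo k : m n / (m < n)%N} /\ u (k n) @[n --> \oo] --> l.

Definition norm_coercive X Y (f : X -> Y) : Prop :=
  forall M : R, exists r : R, forall x, r <= `|x| -> M <= `|f x|.

(* 0 is added to the set of quotients, which are nonnegative, only to make the
   supremum over the empty set (zero domain) equal to 0. *)
Definition Lip_at X Y (g : X -> Y) (x : X) : \bar R :=
  ereal_inf [set ereal_sup (0%E |`
      [set (`|g p.1 - g p.2| / `|p.1 - p.2|)%:E | p in
        [set p : X * X | [/\ ball x r p.1, ball x r p.2 & p.1 != p.2]]])
    | r in [set r : R | 0 < r]].

Definition homeomorphism_inv X Y (f : X -> Y) (g : Y -> X) : Prop :=
  [/\ cancel f g, cancel g f, continuous f & continuous g].

Definition locally_bilipschitz_inv X Y (f : X -> Y) (g : Y -> X) : Prop :=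
  forall x, exists V : set X,
    [/\ open V, V x, [lipschitz f z | z in V], open (f @` V) &
        [lipschitz g w | w in f @` V]].

End pseudo_jacobian.

(* Main.v *)
(* A point x is called e-steep for a locally Lipschitz F when near x the function F
   decreases at rate e in some direction; by Hahn-Banach, if x is not e-steep
   then the Clarke subdifferential of F at x has an element of norm at most e.
   By regularity and the chain rule, F_y is steep wherever f x != y, uniformly
   near each point; with Ekeland's principle this makes f open. The mean value
   theorem for pseudo-Jacobians makes f locally expanding.

   The weighted Palais-Smale condition makes F_y coercive, and steep with a
   uniform rate on each sublevel set away from its zeros. Global injectivity
   uses neither paths of minimal height nor a flow: call the basin of a zero q
   the set of points joined to q by finitely many segments along which F_y
   descends at the uniform rate, robustly under perturbation. Basins are open
   and, by Ekeland's principle, cover X. They are disjoint: Ekeland's principle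
   on the closure of the set B of points in two basins yields a point having a
   neighborhood contained in one basin, while a descending path that starts
   nearby in B and leads to another zero leaves this neighborhood at a point of
   B where F_y is definitely lower. A segment being connected, there is exactly
   one zero. *)
Require Import Defs.
From mathcomp Require Import all_boot all_order all_algebra.
From mathcomp Require Import all_classical all_reals all_analysis.
From mathcomp Require Import measurable_realfun ring lra.

Set Implicit Arguments.
Unset Strict Implicit.
Unset Printing Implicit Defensive.

Import Order.TTheory GRing.Theory Num.Theory.
Import numFieldNormedType.Exports.

Local Open Scope classical_set_scope.
Local Open Scope ring_scope.

(** * Hahn-Banach separation *)

Section supporting_functionals.
Context {R : realType} {V : lmodType R}.
Implicit Types (E : set (V * R)) (u v : V) (a b k : R).

(** A pair [(v, a)] is read as the constraint [w v <= a] on a linear functional [w] still to be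
    built; the last clause makes the constraints at [0] consistent. *)
Definition epi_cone E : Prop :=
  [/\ forall u v a b, E (u, a) -> E (v, b) -> E (u + v, a + b),
      forall k u a, 0 < k -> E (u, a) -> E (k *: u, k * a) &
      forall a, E (0, a) -> 0 <= a].

Lemma epi_cone_maximal E : epi_cone E ->
  exists2 M, E `<=` M & epi_cone M /\
    forall M', M `<=` M' -> epi_cone M' -> M' `<=` M.
Proof.
(* Zorn's lemma is applied to the sets that may be adjoined to [E], so that the empty chain, whose
   union is empty, causes no trouble. *)
move=> coneE; pose P := [set A : set (V * R) | epi_cone (E `|` A)].
have [F PF totF|A [PA maxA]] := @Zorn_bigcup _ P.
- have [->|/set0P[A0 FA0]] := eqVneq F set0.
    by rewrite /P/= bigcup_set0 setU0.
  have pair2 s t : (E `|` \bigcup_(X in F) X) s ->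
      (E `|` \bigcup_(X in F) X) t ->
      exists2 X, F X & (E `|` X) s /\ (E `|` X) t.
    move=> [Es|[A FA As]] [Et|[B FB Bt]].
    + by exists A0 => //; split; left.
    + by exists B => //; split; [left|right].
    + by exists A => //; split; [right|left].
    + have [AB|BA] := totF _ _ FA FB.
        by exists B => //; split; right => //; apply: AB.
      by exists A => //; split; right => //; apply: BA.
  have sub X : F X -> E `|` X `<=` E `|` \bigcup_(X in F) X.
    by move=> FX t [Et|Xt]; [left|right; exists X].
  split=> [u v a b Ea Eb|k u a k0 Ea|a Ea].
  + have [X FX [Xa Xb]] := pair2 _ _ Ea Eb.
    by apply: (sub X FX); have [+ _ _] := PF _ FX; apply.
  + have [X FX [Xa _]] := pair2 _ _ Ea Ea.
    by apply: (sub X FX); have [_ + _] := PF _ FX; apply.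
  + have [X FX [Xa _]] := pair2 _ _ Ea Ea.
    by have [_ _ +] := PF _ FX; apply.
- exists (E `|` A); first by move=> t; left.
  split => // M' EAM coneM' z M'z.
  apply: contrapT => nz; apply: (maxA M'); last first.
    rewrite /P/= (_ : E `|` M' = M')//; apply/setUidPr => t Et.
    by apply: EAM; left.
  split=> [t At|M'A]; first by apply: EAM; right.
  by apply: nz; right; apply: M'A.
Qed.

(* Hahn-Banach: a maximal cone is the epigraph of a functional which, being
   both sublinear and odd, is linear. *)
Lemma epi_cone_linear E : epi_cone E -> (forall v, exists a, E (v, a)) ->
  exists2 w : V -> R^o, linear w & forall v a, E (v, a) -> w v <= a.
Proof.
move=> coneE totE; have [M EM [[MD MZ M0] maxM]] := epi_cone_maximal coneE.
have totM v : exists a, M (v, a) by have [a Ea] := totE v; exists a; apply: EM.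
pose S v := [set a | M (v, a)].
pose q v := inf (S v).
have lbN v a b : M (v, a) -> M (- v, b) -> - b <= a.
  by move=> /MD /[apply]; rewrite subrr => /M0; lra.
have S_inf v : has_inf (S v).
  split; first by have [a Ma] := totM v; exists a.
  have [b Mb] := totM (- v); exists (- b) => a Ma; exact: lbN Ma Mb.
have qle v a : M (v, a) -> q v <= a.
  by move=> Ma; apply: ge_inf => //; have [_ ?] := S_inf v.
have qge v b : (forall a, M (v, a) -> b <= a) -> b <= q v.
  by move=> h; apply: lb_le_inf; [have [] := S_inf v|move=> a; apply: h].
have qD u v : q (u + v) <= q u + q v.
  rewrite -lerBlDr; apply: (qge) => a Ma; rewrite lerBlDl -lerBlDr.
  by apply: (qge) => b Mb; rewrite lerBlDr addrC; apply: qle (MD _ _ _ _ Mb Ma).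
have qZle k v : 0 < k -> q (k *: v) <= k * q v.
  move=> k0; rewrite -ler_pdivrMl//; apply: (qge) => a Ma.
  by rewrite ler_pdivrMl//; apply: qle; apply: MZ.
have qZ k v : 0 < k -> q (k *: v) = k * q v.
  move=> k0; apply/eqP; rewrite eq_le qZle//=.
  rewrite -ler_pdivlMl//.
  apply: le_trans (qZle _ _ _); last by rewrite invr_gt0.
  by rewrite scalerA mulVf ?gt_eqF// scale1r.
have qN v : q (- v) = - q v.
  apply/eqP; rewrite eq_le; apply/andP; split; last first.
    apply: (qge) => b Mb; rewrite lerNl.
    by apply: (qge) => a Ma; exact: lbN Ma Mb.
  rewrite lerNr.
  (* [M'] is [M] plus the ray spanned by [(v, - q (- v))]. It is again a consistent cone, so by
     maximality it adds nothing to [M]. *)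
  pose M' := [set z : V * R | exists t : R, [/\ 0 <= t &
    M (z.1 - t *: v, z.2 + t * q (- v))]].
  have : M' `<=` M.
    apply: maxM => [[u a] Mu|].
      by exists 0; rewrite scale0r mul0r subr0 addr0.
    split=> [u1 u2 a b [s [s0 Ms]] [t [t0 Mt]]|k u a k0 [s [s0 Ms]]|
             a [s [s0 /= Ms]]].
    - exists (s + t); split; first exact: addr_ge0.
      have /= := MD _ _ _ _ Ms Mt.
      by rewrite /= scalerDl opprD addrACA mulrDl [a + b + _]addrACA.
    - exists (k * s); split; first by rewrite mulr_ge0// ltW.
      by have /= := MZ _ _ _ k0 Ms; rewrite /= scalerBr scalerA mulrDr mulrA.
    - move: s0 Ms; rewrite le_eqVlt => /orP[/eqP <-|s0].
        by rewrite scale0r subr0 mul0r addr0; apply: M0.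
      rewrite sub0r -scalerN => /qle; rewrite qZ//; lra.
  move=> M'M; have q0 : q 0 = 0.
    by have := qZ 2%:R 0 (ltr0Sn _ _); rewrite scaler0; lra.
  (* The pair [(0, 0)] need not lie in [M], hence the passage through the infimum [q 0]. *)
  suff : q v + q (- v) <= q 0 by rewrite q0; lra.
  apply: (qge) => a Ma; rewrite -lerBrDr; apply/qle/M'M; exists 1; split=> //=.
  by rewrite scale1r mul1r subrr subrK.
have q0 : q 0 = 0 by have := qN 0; rewrite oppr0; lra.
have {}qZ k v : q (k *: v) = k * q v.
  have [k0|k0|->] := ltgtP k 0; last by rewrite scale0r mul0r.
    have := qZ (- k) v; rewrite oppr_gt0 scaleNr qN => /(_ k0); lra.
  exact: qZ.
exists q => [k u v|v a Ev]; last by apply: qle; apply: EM.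
rewrite -[k *: q u]/(k * q u) -qZ; apply/eqP; rewrite eq_le qD/=.
have := qD (k *: u + v) (- v); rewrite addrK qN; lra.
Qed.
End supporting_functionals.

(** * Linear maps and the operator norm *)

Section operator_norm.
Context {R : realType} {X Y : normedModType R}.
Implicit Types (T : X -> Y).

Lemma linear_scaleE T : linear T -> forall k u, T (k *: u) = k *: T u.
Proof.
move=> lT k u; have T0 : T 0 = 0.
  have := lT 1 0 0; rewrite !scale1r addr0 => /eqP.
  by rewrite -subr_eq subrr => /eqP.
by have := lT k u 0; rewrite !addr0 T0 addr0.
Qed.

Lemma linear_addE T : linear T -> forall u v, T (u + v) = T u + T v.
Proof. by move=> lT u v; have := lT 1 u v; rewrite !scale1r. Qed.

Lemma linear_oppE T : linear T -> forall u, T (- u) = - T u.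
Proof. by move=> lT u; rewrite -scaleN1r linear_scaleE// scaleN1r. Qed.

Lemma linear_subE T : linear T -> forall u v, T (u - v) = T u - T v.
Proof. by move=> lT u v; rewrite linear_addE// linear_oppE. Qed.

Lemma linear_0E T : linear T -> T 0 = 0.
Proof. by move=> lT; rewrite -(scale0r (0 : X)) linear_scaleE// scale0r. Qed.

Lemma opnorm_le T k : (forall u, `|T u| <= k * `|u|) -> 0 <= k ->
  (opnorm T <= k%:E)%E.
Proof.
move=> Tk k0; apply: ge_ereal_sup => _ [u /= u1 <-]; rewrite lee_fin.
by apply: le_trans (Tk u) _; rewrite ler_piMr.
Qed.

Lemma le_opnorm T k u : linear T -> (opnorm T <= k%:E)%E ->
  `|T u| <= k * `|u|.
Proof.
move=> lT Tk; have [->|u0] := eqVneq u 0.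
  by rewrite linear_0E// !normr0 mulr0.
have nu : 0 < `|u| by rewrite normr_gt0.
have : ((`|T (`|u|^-1 *: u)|)%:E <= k%:E)%E.
  apply: le_trans Tk; apply: ereal_sup_ubound; exists (`|u|^-1 *: u) => //=.
  by rewrite normrZ normfV normr_id mulVf// gt_eqF.
by rewrite lee_fin linear_scaleE// normrZ normfV normr_id mulrC ler_pdivrMr.
Qed.

Lemma opnorm_ge0 T : (0 <= opnorm T)%E.
Proof.
apply: (@le_trans _ _ (`|T 0|)%:E); first by rewrite lee_fin.
by apply: ereal_sup_ubound; exists 0 => //=; rewrite normr0.
Qed.

Lemma opnorm_fin T : (opnorm T < +oo)%E ->
  exists2 k : R, 0 <= k & opnorm T = k%:E.
Proof.
move=> To; have fT : opnorm T \is a fin_num.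
  by rewrite ge0_fin_numE// opnorm_ge0.
exists (fine (opnorm T)); last by rewrite fineK.
by apply: fine_ge0; apply: opnorm_ge0.
Qed.

End operator_norm.

Section convex_hull.
Context {R : realType} {X Y : normedModType R}.
Implicit Types (A B : set (X -> Y)).

Lemma sub_conv_hull A : A `<=` conv_hull A.
Proof. exact: sub_smallest. Qed.

Lemma conv_hullS A B : A `<=` B -> conv_hull A `<=` conv_hull B.
Proof.
by move=> AB T AT C [cC BC]; apply: AT; split=> // S AS; apply/BC/AB.
Qed.

Lemma conv_hull_combination A S T s t : conv_hull A S -> conv_hull A T ->
  0 <= s -> 0 <= t -> s + t = 1 -> conv_hull A (s *: S + t *: T).
Proof.
move=> AS AT s0 t0 st1 C [cC AC].
have s1 : s <= 1 by rewrite -st1 lerDl.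
have := cC S T (Itv01 s0 s1).
rewrite !inE => /(_ (AS C (conj cC AC)) (AT C (conj cC AC))).
have -> : t = 1 - s by lra.
exact.
Qed.

End convex_hull.

(** * Separation of a point from a convex set *)

Section hahn_banach.
Context {R : realType} {X : normedModType R}.
Implicit Types (A : set X).

(* The functional lies below the sublinear map
   v |-> inf {`|v + t (z - a)| - t e | 0 <= t, A a}. *)
Lemma separation A (z : X) (e : R) : A !=set0 ->
  (forall a b (s t : R), A a -> A b -> 0 <= s -> 0 <= t -> s + t = 1 ->
     A (s *: a + t *: b)) ->
  (forall a, A a -> e <= `|a - z|) ->
  exists2 w : X -> R^o, linear w & (forall u, `|w u| <= `|u|) /\
     forall a, A a -> w a + e <= w z.
Proof.
move=> [a0 Aa0] cA Ae.
pose E := [set p : X * R | exists (t : R) a, [/\ 0 <= t, A a &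
  `|p.1 + t *: (z - a)| - t * e <= p.2]].
have Etot v : E (v, `|v|).
  by exists 0, a0; split=> //=; rewrite scale0r mul0r addr0 subr0.
have coneE : epi_cone E.
  split=> [u v a b [s [c [s0 Ac /= Ea]]] [t [d [t0 Ad /= Eb]]]|
           k u a k0 [t [c [t0 Ac /= Ea]]]|a [t [c [t0 Ac /= Ea]]]].
  - have [st0|st0] := eqVneq (s + t) 0.
      have [s0' t0'] : s = 0 /\ t = 0 by lra.
      move: Ea Eb; rewrite s0' t0' !scale0r !mul0r !addr0 !subr0 => Ea Eb.
      exists 0, c; split=> //=; rewrite scale0r mul0r addr0 subr0.
      by apply: le_trans (ler_normD _ _) _; exact: lerD.
    have stp : 0 < s + t by rewrite lt_neqAle eq_sym st0 addr_ge0.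
    exists (s + t), ((s / (s + t)) *: c + (t / (s + t)) *: d); split.
    + exact: addr_ge0.
    + apply: cA => //; [by rewrite divr_ge0 ?addr_ge0..|].
      by rewrite -mulrDl divff.
    + rewrite /= scalerBr scalerDr !scalerA ![(s + t) * _]mulrC !divfK//.
      have -> : u + v + ((s + t) *: z - (s *: c + t *: d)) =
          (u + s *: (z - c)) + (v + t *: (z - d)).
        by rewrite !scalerBr scalerDl opprD (addrACA (s *: z)) [LHS]addrACA.
      rewrite lerBlDr; apply: le_trans (ler_normD _ _) _; lra.
  - exists (k * t), c; split=> //=; first by rewrite mulr_ge0// ltW.
    rewrite -scalerA -scalerDr normrZ gtr0_norm// -mulrA -mulrBr.
    by rewrite ler_pM2l.
  - apply: le_trans Ea; rewrite add0r normrZ ger0_norm// -mulrBr.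
    by rewrite mulr_ge0// subr_ge0 distrC Ae.
have [w lw wE] :=
  epi_cone_linear coneE (fun v => ex_intro (fun a => E (v, a)) _ (Etot v)).
exists w => //; split=> [u|a Aa].
  rewrite ler_norml wE// andbT lerNl.
  by have := wE _ _ (Etot (- u)); rewrite (linear_oppE lw) normrN.
have := wE (a - z) (- e); rewrite (linear_subE lw).
have -> : E (a - z, - e) = True; last by move=> /(_ I); lra.
apply/propext; split=> // _; exists 1, a; split=> //=.
by rewrite scale1r mul1r addrA subrK subrr normr0 add0r.
Qed.

(** Separation of [u] from the convex set [{0}], which lies at distance [|u|]. *)
Lemma norming_functional (u : X) :
  exists2 w : X -> R^o, linear w & (forall v, `|w v| <= `|v|) /\ w u = `|u|.
Proof.
have [|a b s t -> -> _ _ _|a ->|w lw [wle wu]] := @separation [set 0] u `|u|.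
- by exists 0.
- by rewrite !scaler0 addr0.
- by rewrite sub0r normrN.
exists w => //; split=> //; apply/eqP; rewrite eq_le; apply/andP; split.
  by apply: le_trans (wle u); exact: ler_norm.
have := wu 0 erefl.
by rewrite (linear_0E lw) add0r.
Qed.

End hahn_banach.

(** * Clarke subdifferentials *)

Section local_lipschitz.
Context {R : realType} {X Y : normedModType R}.

Lemma lipschitz_onP (f : X -> Y) (V : set X) : [lipschitz f z | z in V] <->
  exists2 L : R, 0 <= L &
    forall z w, V z -> V w -> `|f z - f w| <= L * `|z - w|.
Proof.
split=> [|[L L0 fL]].
  move=> /pinfty_ex_gt0[L L0 fL]; exists L; first exact: ltW.
  by move=> z w Vz Vw; apply: (fL (z, w)).
exists L; split; first exact: num_real.
move=> M LM [z w] [/= Vz Vw]; apply: le_trans (fL _ _ Vz Vw) _.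
by rewrite ler_wpM2r// ltW.
Qed.

Lemma locally_lipschitz_ball (f : X -> Y) (x : X) : locally_lipschitz f ->
  exists r L : R, [/\ 0 < r, 0 <= L & forall z w, `|z - x| < r ->
    `|w - x| < r -> `|f z - f w| <= L * `|z - w|].
Proof.
move=> /(_ x)[V /nbhs_ballP[r /= r0 rV]] /lipschitz_onP[L L0 fL].
exists r, L; split=> // z w zx wx.
by apply: fL; apply: rV; rewrite -ball_normE /= distrC.
Qed.

Lemma locally_lipschitz_continuous (f : X -> Y) :
  locally_lipschitz f -> continuous f.
Proof.
move=> lf x; have [r [L [r0 L0 fL]]] := locally_lipschitz_ball x lf.
apply/cvgrPdist_lt => e e0.
have L1 : 0 < L + 1 by rewrite ltr_wpDl.
apply/nbhs_ballP; exists (Num.min r (e / (L + 1))) => /=.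
  by rewrite lt_min r0 divr_gt0.
move=> z; rewrite -ball_normE /= lt_min ltr_pdivlMr// => /andP[zr ze].
apply: le_lt_trans ze; apply: le_trans (fL _ _ _ _) _.
- by rewrite subrr normr0.
- by rewrite distrC.
- by rewrite mulrC ler_wpM2l// lerDl.
Qed.

End local_lipschitz.

Section clarke.
Context {R : realType} {X : normedModType R}.
Implicit Types (phi : X -> R) (x v : X).

(** The Clarke derivative is the infimum of these real bounds, which replace the upper limit in the
    extended reals from here on. *)
Definition clarke_bound phi x v (a : R) : Prop :=
  exists2 r : R, 0 < r & forall z t, `|z - x| < r -> 0 < t -> t < r ->
    phi (z + t *: v) <= phi z + a * t.

Lemma clarke_derivative_le phi x v a : clarke_bound phi x v a ->
  (clarke_derivative phi x v <= a%:E)%E.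
Proof.
move=> [r r0 phia].
pose V := [set zt : X * R | `|zt.1 - x| < r /\ 0 < zt.2 < r].
apply: (@le_trans _ _ (ereal_sup
  [set ((phi (zt.1 + zt.2 *: v) - phi zt.1) / zt.2)%:E | zt in V])).
  apply: ereal_inf_lbound; exists V => //.
  exists (ball x r, [set t : R | 0 < t < r]).
    split=> /=; first exact: nbhsx_ballx.
    apply/nbhs_ballP; exists r => //= t; rewrite -ball_normE /= sub0r normrN.
    by move=> tr t0; rewrite t0 (le_lt_trans (ler_norm t) tr).
  by move=> [z t] /= []; rewrite -ball_normE /= distrC.
apply: ge_ereal_sup => _ [[z t] /= [zr /andP[t0 tr]] <-].
by rewrite lee_fin ler_pdivrMr// lerBlDl; apply: phia.
Qed.

Lemma le_clarke_derivative phi x v c :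
  (forall a, clarke_bound phi x v a -> c <= a) ->
  (c%:E <= clarke_derivative phi x v)%E.
Proof.
move=> ca; apply: le_ereal_inf_tmp => _ [V [[A B] /= [Ax B0] AB] <-].
rewrite leNgt; apply/negP => sc.
have [b /andP[sb bc]] : exists b : R, (ereal_sup
    [set ((phi (zt.1 + zt.2 *: v) - phi zt.1) / zt.2)%:E | zt in V]
    <= b%:E)%E && (b < c).
  case: (ereal_sup _) sc => [s| |] //.
  - by rewrite lte_fin => sc; exists s; rewrite lexx.
  - by move=> _; exists (c - 1); rewrite leNye/= ltrBlDr ltrDl.
suff : clarke_bound phi x v b by move=> /ca; rewrite leNgt bc.
have /nbhs_ballP[r r0 rA] := Ax; have /nbhs_ballP[s s0 sB] := B0.
exists (Num.min r s); first by rewrite lt_min r0.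
move=> z t; rewrite !lt_min => /andP[zr _] t0 /andP[_ ts].
rewrite -lerBlDl -ler_pdivrMr// -lee_fin; apply: le_trans sb.
apply: ereal_sup_ubound; exists (z, t) => //; apply: AB; split=> /=.
  by apply: rA; rewrite -ball_normE /= distrC.
by apply: sB => //; rewrite -ball_normE /= sub0r normrN gtr0_norm.
Qed.

Lemma clarke_subdiffP phi x w : clarke_subdiff phi x w <->
  dual w /\ forall v a, clarke_bound phi x v a -> w v <= a.
Proof.
split=> -[dw wphi]; split=> // v.
  by move=> a /clarke_derivative_le; rewrite -lee_fin; apply: le_trans.
by apply: le_clarke_derivative => a; apply: wphi.
Qed.

(** Subadditivity of the Clarke derivative: since the base point may vary, the bound along [v] is
    used at [z + t *: u]. Dividing the radius by [1 + |u|] keeps this point close enough to [x]. *)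
Lemma clarke_boundD phi x u v a b : clarke_bound phi x u a ->
  clarke_bound phi x v b -> clarke_bound phi x (u + v) (a + b).
Proof.
move=> [r r0 phia] [s s0 phib]; pose m := Num.min r s / 2.
have m0 : 0 < m by rewrite divr_gt0// lt_min r0.
have mr : m < r by rewrite ltr_pdivrMr// gt_min ltr_pMr// ltr1n.
have ms : m + m <= s by rewrite -mulr2n -mulr_natr divfK// ge_min lexx orbT.
have k0 : 1 <= 1 + `|u| by rewrite lerDl.
have le_m t : t < m / (1 + `|u|) -> t < m.
  move=> /lt_le_trans; apply.
  by rewrite ler_pdivrMr ?(lt_le_trans _ k0)// ler_peMr// ltW.
exists (m / (1 + `|u|)) => [|z t zm t0 tm].
  by rewrite divr_gt0// (lt_le_trans _ k0).
have tu : t * `|u| <= m.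
  rewrite ltr_pdivlMr ?(lt_le_trans _ k0)// in tm.
  by apply/ltW/(le_lt_trans _ tm); rewrite ler_pM2l// lerDr.
rewrite scalerDr addrA mulrDl.
apply: le_trans (phib _ _ _ t0 _) _.
- rewrite addrAC; apply: le_lt_trans (ler_normD _ _) _.
  rewrite normrZ gtr0_norm//; apply: lt_le_trans ms.
  by rewrite ltr_leD// le_m.
- by apply: lt_le_trans (le_m _ tm) _; apply: le_trans ms; rewrite lerDl ltW.
- rewrite addrA lerD2r; apply: phia => //; apply: lt_trans mr; exact: le_m.
Qed.

Lemma clarke_boundZ phi x k v a : 0 < k -> clarke_bound phi x v a ->
  clarke_bound phi x (k *: v) (k * a).
Proof.
move=> k0 [r r0 phia]; exists (Num.min r (r / k)).
  by rewrite lt_min r0 divr_gt0.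
move=> z t; rewrite lt_min => /andP[zr _] t0; rewrite lt_min => /andP[_ tr].
rewrite scalerA (_ : k * a * t = a * (t * k)); last by ring.
by apply: phia; rewrite ?mulr_gt0// -ltr_pdivlMr.
Qed.

Lemma clarke_bound_lipschitz phi x v : locally_lipschitz (phi : X -> R^o) ->
  exists a, clarke_bound phi x v a.
Proof.
move=> lphi; have [r [L [r0 L0 fL]]] := locally_lipschitz_ball x lphi.
pose k := 1 + `|v|; have k1 : 1 <= k by rewrite lerDl.
have k0 : 0 < k by rewrite (lt_le_trans _ k1).
exists (L * `|v|), (r / 2 / k); first by rewrite !divr_gt0.
move=> z t zr t0; rewrite ltr_pdivlMr// => tr.
have zr2 : `|z - x| < r / 2.
  by apply: (lt_le_trans zr); rewrite ler_pdivrMr// ler_peMr// divr_ge0// ltW.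
rewrite -lerBlDl; apply: le_trans (ler_norm _) _.
apply: le_trans (fL _ _ _ _) _.
- rewrite addrAC; apply: le_lt_trans (ler_normD _ _) _.
  rewrite [ltRHS]splitr normrZ gtr0_norm// ltrD//; apply: le_lt_trans tr.
  by rewrite ler_pM2l// lerDr.
- by apply: lt_trans zr2 _; rewrite ltr_pdivrMr// ltr_pMr// ltr1n.
- by rewrite addrAC subrr add0r normrZ gtr0_norm// mulrCA mulrC.
Qed.

(* The functional is squeezed between [- e `|v|] and the Clarke derivative. *)
Lemma clarke_subdiff_le phi x (e : R) :
  locally_lipschitz (phi : X -> R^o) -> 0 <= e ->
  (forall v a, clarke_bound phi x v a -> - (e * `|v|) <= a) ->
  exists2 w : X -> R^o, clarke_subdiff phi x w & (opnorm w <= e%:E)%E.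
Proof.
move=> lphi e0 phie.
(* The cone lies over the infimal convolution of the Clarke derivative with [e] times the norm; its
   consistency at [0] is exactly the hypothesis on [phi]. *)
pose E := [set p : X * R | exists u a,
  clarke_bound phi x (p.1 + u) a /\ a + e * `|u| <= p.2].
have coneE : epi_cone E.
  split=> [u v a b [u' [a' [/= ua aa]]] [v' [b' [/= vb bb]]]|
           k u a k0 [u' [a' [/= ua aa]]]|a [u' [a' [/= ua aa]]]].
  - exists (u' + v'), (a' + b') => /=; split.
      by rewrite addrACA; apply: clarke_boundD.
    apply: le_trans (lerD aa bb); rewrite [leRHS]addrACA lerD2l -mulrDr.
    by rewrite ler_wpM2l// ler_normD.
  - exists (k *: u'), (k * a') => /=; split.
      by rewrite -scalerDr; apply: clarke_boundZ.
    by rewrite normrZ gtr0_norm// mulrCA -mulrDr ler_pM2l.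
  - by apply: le_trans aa; rewrite -lerBlDr sub0r phie// -[u']add0r.
have [v|w lw wE] := epi_cone_linear coneE.
  have [a av] := clarke_bound_lipschitz x v lphi.
  by exists a, 0, a; rewrite /= addr0 normr0 mulr0 addr0.
have w_le v : w v <= e * `|v|.
  apply: wE; exists (- v), 0 => /=; rewrite subrr normrN add0r; split=> //.
  by exists 1 => // z t _ _ _; rewrite scaler0 mul0r !addr0.
have opw : (opnorm w <= e%:E)%E.
  apply: opnorm_le => // v; rewrite ler_norml w_le andbT lerNl.
  by rewrite -(linear_oppE lw) -[`|v|]normrN.
exists w => //; apply/clarke_subdiffP; split=> [|v a va].
  by split=> //; apply: le_lt_trans opw _; rewrite ltry.
by apply: wE; exists 0, a => /=; rewrite addr0 normr0 mulr0 addr0.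
Qed.

End clarke.

(** * Ekeland's variational principle *)

Section ekeland.
Context {R : realType} {X : completeNormedModType R}.

Lemma closed_sublevel (G : X -> R^o) (c : R) : continuous G ->
  closed [set z | G z <= c].
Proof.
by move=> cG; apply: (@closed_comp _ _ G [set t | t <= c]) => //; exact: closed_le.
Qed.

(** The sets [S x] are the upper sections of a partial order. A sequence that descends fast enough
    in this order is Cauchy, because [e] times the distance is paid for by the decrease of [F], and
    its limit is minimal. *)
Lemma ekeland (A : set X) (F : X -> R^o) (e : R) (x0 : X) :
  0 < e -> closed A -> continuous F -> (forall x, A x -> 0 <= F x) -> A x0 ->
  exists x1, [/\ A x1, F x1 + e * `|x1 - x0| <= F x0 &
    forall z, A z -> F z + e * `|z - x1| <= F x1 -> z = x1].
Proof.
move=> e0 cA cF F0 Ax0.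
pose S x := [set z | A z /\ F z + e * `|z - x| <= F x].
have Sxx x : A x -> S x x.
  by move=> Ax; split=> //; rewrite subrr normr0 mulr0 addr0.
have Strans x y z : S x y -> S y z -> S x z.
  move=> [_ xy] [Az yz]; split=> //; apply: le_trans xy.
  have := ler_distD y z x; rewrite -(ler_pM2l e0) mulrDr; lra.
(* Each step achieves at least half of the decrease of [F] available in [S x]. *)
have step x : exists z, A x -> S x z /\ forall w, S x w -> 2 * F z - F x <= F w.
  have [Ax|nAx] := pselect (A x); last by exists x.
  have iS : has_inf (F @` S x).
    split; first by exists (F x), x => //; apply: Sxx.
    by exists 0 => _ [z [Az _] <-]; apply: F0.
  have lbS w : S x w -> inf (F @` S x) <= F w.
    by move=> Sw; apply: ge_inf; [case: iS|exists w].
  have [Fx|Fx] := leP (F x) (inf (F @` S x)).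
    by exists x => _; split=> [|w /lbS]; [exact: Sxx|lra].
  have [|_ [z Sz <-] zlt] :=
      @inf_adherent _ (F @` S x) ((F x - inf (F @` S x)) / 2) _ iS.
    by rewrite divr_gt0// subr_gt0.
  by exists z => _; split=> // w /lbS; lra.
have [next nextP] := choice step.
pose u n := iter n next x0.
have uS n : A (u n) /\ S (u n) (u n.+1).
  elim: n => [|n [_ [Au _]]]; split=> //; first by case: (nextP _ Ax0).
  by case: (nextP _ Au).
have uA n : A (u n) by case: (uS n).
have uSS n m : (n <= m)%N -> S (u n) (u m).
  elim: m => [|m IH]; first by rewrite leqn0 => /eqP ->; apply: Sxx.
  rewrite leq_eqVlt => /predU1P[->|]; first exact: Sxx.
  by rewrite ltnS => /IH h; apply: Strans h _; case: (uS m).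
pose L := inf (range (F \o u)).
have iL : has_inf (range (F \o u)).
  by split; [exists (F (u 0)), 0%N|exists 0 => _ [n _ <-]; apply: F0].
have LF n : L <= F (u n) by apply: ge_inf; [case: iL|exists n].
have cu : cvg (u @ \oo).
  suff : cauchy_ex (u @ \oo) by move=> /cauchy_exP; exact: cauchy_cvg.
  move=> d d0.
  have [|_ [n _ <-] /= nlt] := @inf_adherent _ _ (e * d) _ iL; first exact: mulr_gt0.
  exists (u n); exists n => // m /= nm; rewrite -ball_normE /= distrC.
  have [_ le_nm] := uSS _ _ nm; rewrite -(ltr_pM2l e0).
  have := LF m; rewrite /L; lra.
pose x1 : X := lim (u @ \oo); have ux1 : u @ \oo --> x1 := cu.
have Sx1 n : S (u n) x1.
  split; first by apply: (closed_cvg _ cA _ _ ux1); apply: nearW => m; apply: uA.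
  have cG : continuous (fun z : X => F z + e * `|z - u n| : R^o).
    move=> z; apply: cvgD; first exact: cF.
    apply: cvgM; first exact: cvg_cst.
    by apply: cvg_norm; apply: cvgB; [exact: cvg_id|exact: cvg_cst].
  change ([set z | F z + e * `|z - u n| <= F (u n)] x1).
  pose C := [set z | F z + e * `|z - u n| <= F (u n)].
  have cC : closed C := closed_sublevel (c := F (u n)) cG.
  rewrite -/C; apply: (closed_cvg C cC _ _ ux1).
  by exists n => // m /= nm; case: (uSS _ _ nm).
exists x1; split; [by case: (Sx1 0)|by case: (Sx1 0)|] => z Az zx1.
(* A competitor [z] of [x1] lies in every [S (u n)], so [F z] is at least the limit [L] of the
   values, while [F x1] is at most [L]. *)
have FzL n : F z >= 2 * F (u n.+1) - F (u n).
  by have [_] := nextP _ (uA n); apply; apply: Strans (Sx1 n) _.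
have Fx1L : F x1 <= L.
  apply: lb_le_inf => [|_ [n _ <-]]; first by case: iL.
  have [_ h] := Sx1 n; apply: le_trans h; rewrite lerDl mulr_ge0//; lra.
have LFz : L <= F z.
  apply/ler_addgt0Pr => d d0.
  have [_ [n _ <-] /= nlt] := @inf_adherent _ _ d d0 iL.
  have := FzL n; have := LF n.+1; rewrite -/L in nlt *; lra.
have : e * `|z - x1| <= 0 by lra.
by rewrite pmulr_rle0// normr_le0 subr_eq0 => /eqP.
Qed.
End ekeland.

(** * Steepness and the chain rule *)

Section steepness.
Context {R : realType} {X : normedModType R}.
Implicit Types (F : X -> R^o) (x v : X) (e : R).

(** A single direction [v] serves all base points near [x], as in the Clarke derivative; this makes
    steepness an open condition. *)
Definition steep F e x : Prop :=
  exists v r, [/\ v != 0, 0 < r & forall z t, `|z - x| < r -> 0 < t -> t < r ->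
    F (z + t *: v) <= F z - e * (t * `|v|)].

Lemma steep_le F e e' x : e <= e' -> steep F e' x -> steep F e x.
Proof.
move=> ee [v [r [v0 r0 Fv]]]; exists v, r; split=> // z t zx t0 tr.
apply: le_trans (Fv z t zx t0 tr) _.
by rewrite lerB// ler_wpM2r// mulr_ge0// ltW.
Qed.

Lemma steep_open F e : open [set x | steep F e x].
Proof.
rewrite openE => x [v [r [v0 r0 Fv]]].
apply/nbhs_ballP; exists (r / 2) => [|y]; first exact: divr_gt0.
rewrite -ball_normE /= => xy; exists v, (r / 2); split=> //; first exact: divr_gt0.
move=> z t zy t0 tr; apply: Fv => //.
  rewrite [r]splitr; apply: le_lt_trans (ler_distD y _ _) _.
  by rewrite ltrD// distrC.
by apply: lt_trans tr _; rewrite ltr_pdivrMr// ltr_pMr// ltr1n.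
Qed.

(** Without steepness no direction has a Clarke bound below [- (e * |v|)], which is what
    [clarke_subdiff_le] asks for. *)
Lemma not_steep_subdiff F e x : locally_lipschitz F -> 0 <= e ->
  ~ steep F e x ->
  exists2 w : X -> R^o, clarke_subdiff F x w & (opnorm w <= e%:E)%E.
Proof.
move=> lF e0 nst; apply: clarke_subdiff_le => // v a [r r0 Fa].
rewrite leNgt; apply/negP => av; apply: nst.
(* Steepness demands a nonzero direction; in direction [0] a negative bound is absurd. *)
have [v0|v0] := eqVneq v 0.
  have := Fa x (r / 2); rewrite subrr normr0 v0 scaler0 addr0.
  have r2 : 0 < r / 2 by rewrite divr_gt0.
  have r2r : r / 2 < r by rewrite ltr_pdivrMr// ltr_pMr// ltr1n.
  move: av; rewrite v0 normr0 mulr0 oppr0 => a0 /(_ r0 r2 r2r).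
  by rewrite lerDl leNgt nmulr_rlt0// r2.
exists v, r; split=> // z t zx t0 tr; apply: le_trans (Fa z t zx t0 tr) _.
rewrite lerD2l (_ : - (e * (t * `|v|)) = - (e * `|v|) * t); last by ring.
by rewrite ler_pM2r// ltW.
Qed.

(** The point [z] is what contradicts minimality in Ekeland's principle. *)
Lemma steep_descent F e x (d : R) : 0 < d -> steep F e x ->
  exists z, [/\ z != x, `|z - x| < d & F z + e * `|z - x| <= F x].
Proof.
move=> d0 [v [r [v0 r0 Fv]]]; have nv : 0 < `|v| by rewrite normr_gt0.
pose t := Num.min (r / 2) (d / 2 / `|v|).
have t0 : 0 < t by rewrite lt_min !divr_gt0.
have tr : t < r by rewrite gt_min ltr_pdivrMr// ltr_pMr// ltr1n.
have td : t * `|v| < d.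
  rewrite -ltr_pdivlMr// gt_min; apply/orP; right.
  by rewrite ltr_pM2r ?invr_gt0// ltr_pdivrMr// ltr_pMr// ltr1n.
exists (x + t *: v); rewrite [x + _ - x]addrAC subrr add0r normrZ gtr0_norm//.
split=> //.
  by rewrite -subr_eq0 addrAC subrr add0r scaler_eq0 gt_eqF.
by rewrite -lerBrDr; apply: Fv => //; rewrite subrr normr0.
Qed.

End steepness.

(** * Subgradients of the norm *)

Section norm_subdiff.
Context {R : realType} {Y : normedModType R}.

Lemma clarke_subdiff_norm (w : Y) (y : Y -> R^o) : w != 0 ->
  clarke_subdiff (fun z : Y => `|z|) w y ->
  [/\ dual y, forall u, `|y u| <= `|u| & opnorm y = 1%E].
Proof.
move=> w0 /clarke_subdiffP[[ly oy] yb].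
have y_le u : y u <= `|u|.
  apply: yb; exists 1 => // z t _ t0 _; apply: le_trans (ler_normD _ _) _.
  by rewrite normrZ gtr0_norm// mulrC.
have y_abs u : `|y u| <= `|u|.
  by rewrite ler_norml y_le andbT lerNl -(linear_oppE ly) -[`|u|]normrN.
have nw : 0 < `|w| by rewrite normr_gt0.
(* The test direction is [- w]: for [z] near [w], the point [z - t w] is [(1 - t) z + t (z - w)], so
   the norm drops at a rate close to [|w|]. *)
have yw : `|w| <= y w.
  apply/ler_addgt0Pr => d d0; rewrite -lerBlDr -lerN2 -(linear_oppE ly) opprB.
  apply: yb; pose r := Num.min 1 (d / 2).
  have r0 : 0 < r by rewrite lt_min ltr01 divr_gt0.
  have [r1 rd] : r <= 1 /\ r <= d / 2 by split; rewrite ge_min lexx ?orbT.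
  exists r => // z t zw t0 tr.
  have -> : z + t *: - w = (1 - t) *: z + t *: (z - w).
    by rewrite scalerBl scale1r scalerBr scalerN addrA subrK.
  apply: le_trans (ler_normD _ _) _.
  rewrite !normrZ gtr0_norm ?subr_gt0 ?(lt_le_trans tr)//.
  rewrite gtr0_norm//; have := ler_normD (w - z) z; rewrite subrK distrC => wz.
  have : t * `|w| <= t * (`|z - w| + `|z|) by rewrite ler_pM2l.
  have : t * `|z - w| <= t * (d / 2) by rewrite ler_pM2l// ltW// (lt_le_trans zw).
  rewrite mulrDr; lra.
split=> //; apply/eqP; rewrite eq_le; apply/andP; split.
  by apply: opnorm_le => // u; rewrite mul1r.
have : ((`|y (`|w|^-1 *: w)|)%:E <= opnorm y)%E.
  apply: ereal_sup_ubound; exists (`|w|^-1 *: w) => //=.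
  by rewrite normrZ normfV normr_id mulVf// gt_eqF.
apply: le_trans; rewrite lee_fin (linear_scaleE ly) normrM normfV normr_id.
by rewrite mulrC ler_pdivlMr// mul1r (le_trans yw)// ler_norm.
Qed.

End norm_subdiff.

(** * Regularity and subgradients of the distance functionals *)

Section chain_rule.
Context {R : realType} {X Y : normedModType R}.
Variables (f : X -> Y) (Jf : X -> set (X -> Y)).

(** Regularity with explicit radius and constant: the same [r] and [c] control expansion, local
    surjectivity and the Lipschitz constant of the inverse. *)
Definition sur_bound (x : X) (r c : R) : Prop := forall T,
  conv_hull_ball Jf x r T -> isomorphism T /\ (c%:E <= surj_modulus T)%E.

Lemma regular_sur_bound x c : regular_at Jf x -> (c%:E < reg_index Jf x)%E ->
  exists2 r : R, 0 < r & sur_bound x r c.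
Proof.
move=> [[r r0 isoT] _] /ereal_sup_gt[_ [s /= s0 <-] cs].
have sub a b : a <= b -> conv_hull_ball Jf x a `<=` conv_hull_ball Jf x b.
  move=> ab; apply: conv_hullS => T [z xz JT]; exists z => //.
  exact: le_ball xz.
exists (Num.min r s); first by rewrite lt_min r0.
move=> T xT; split; first by apply: isoT; apply: sub xT; rewrite ge_min lexx.
apply: le_trans (ltW cs) _; apply: ereal_inf_lbound; exists T => //.
by apply: sub xT; rewrite ge_min lexx orbT.
Qed.

Lemma dist_fun_lipschitz y : locally_lipschitz f -> locally_lipschitz (dist_fun f y).
Proof.
move=> lf x; have [V Vx /lipschitz_onP[L L0 fL]] := lf x.
exists V => //; apply/lipschitz_onP; exists L => // z w Vz Vw.
apply: le_trans (fL z w Vz Vw); rewrite /dist_fun.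
apply: le_trans (ler_dist_dist _ _) _.
by rewrite opprB addrA subrK.
Qed.

Hypothesis f_chain : strong_chain_rule f Jf.

(** The chain rule writes [w] as [y' \o T] with [y'] of norm one and [T] a limit of operators [S] of
    the convex hull. For these, [c] bounds the norm of [y' \o S] from below, and replacing [S] by
    [T] costs at most the norm of [T - S]. *)
Lemma le_opnorm_subdiff x0 (r c : R) x y (w : X -> R^o) : sur_bound x0 r c ->
  `|x - x0| < r -> y != f x -> clarke_subdiff (dist_fun f y) x w ->
  (c%:E <= opnorm w)%E.
Proof.
move=> sb xr yfx wx; have [_ _ _ /(_ w wx)] := f_chain.2 x y yfx.
move=> [[y' T] /= [y'd [LT Tapp]] <-].
have nz : f x - y != 0 by rewrite subr_eq0 eq_sym.
have [y'D y'1 y'o] := clarke_subdiff_norm nz y'd.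
have [ly' _] := y'D.
apply/lee_addgt0Pr => d d0; have [S JS TS] := Tapp d d0.
have := opnorm_ge0 (y' \o T); case TSk : (opnorm (y' \o T)) => // [k|] k0; last first.
  by rewrite leey.
have S_hull : conv_hull_ball Jf x0 r S.
  apply: conv_hullS JS => U JU; exists x => //=.
  by rewrite -ball_normE /= distrC.
have [_ cS] := sb S S_hull; apply: le_trans cS _.
apply: (@le_trans _ _ (opnorm (y' \o S))).
  by apply: ereal_inf_lbound; exists y'.
apply: ge_ereal_sup => _ [u /= u1 <-].
have Tu : ((`|(y' \o T) u|)%:E <= k%:E)%E.
  by rewrite -TSk; apply: ereal_sup_ubound; exists u.
have Su : ((`|(T - S) u|)%:E < d%:E)%E.
  by apply: le_lt_trans TS; apply: ereal_sup_ubound; exists u.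
rewrite lee_fin in Tu; rewrite lte_fin in Su.
rewrite -EFinD lee_fin -(subKr (T u) (S u)) (linear_subE ly').
apply: le_trans (ler_normB _ _) _; rewrite lerD//.
by apply: le_trans (y'1 _) _; exact: ltW.
Qed.

Lemma steep_dist_fun x0 (r c e : R) x y : sur_bound x0 r c -> `|x - x0| < r ->
  y != f x -> 0 <= e -> e < c -> steep (dist_fun f y) e x.
Proof.
move=> sb xr yfx e0 ec.
apply: contrapT => /not_steep_subdiff -/(_ _ e0)[|w wx we].
  by apply: dist_fun_lipschitz; case: f_chain.
have := le_trans (le_opnorm_subdiff sb xr yfx wx) we.
by rewrite lee_fin leNgt ec.
Qed.

End chain_rule.

(** * Mean value inequality and local inversion *)

Section dini.
Context {R : realType}.

(** The parameters [t] where [phi t - m * t <= phi 0] form a closed set, whose supremum could be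
    pushed to the right if it were less than [1]. *)
Lemma dini_increment_le (phi : R -> R^o) (m : R) : continuous phi ->
  (forall t, 0 <= t -> t < 1 -> exists2 d : R, 0 < d &
     forall s, 0 < s -> s < d -> phi (t + s) <= phi t + m * s) ->
  phi 1 <= phi 0 + m.
Proof.
move=> cphi dphi.
pose S := [set t : R | 0 <= t <= 1] `&` [set t | phi t - m * t <= phi 0].
have cS : closed S.
  apply: closedI.
    rewrite [X in closed X](_ : _ = `[0, 1]%classic); first exact: itv_closed.
    by apply/seteqP; split=> t /=; rewrite in_itv.
  apply: closed_sublevel => t; apply: cvgB; first exact: cphi.
  by apply: cvgM; [exact: cvg_cst|exact: cvg_id].
have S0 : S 0 by split => /=; rewrite ?lexx ?ler01// mulr0 subr0.
have S1 : ubound S 1 by move=> t [/andP[]].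
have supS : has_sup S by split; [exists 0|exists 1].
have [s01 /= Ss] : S (sup S) by apply: cS; apply: closure_sup; [exists 0|exists 1].
have [s1|s1] := eqVneq (sup S) 1; first by move: Ss; rewrite s1; lra.
have {}s1 : sup S < 1 by rewrite lt_neqAle s1; case/andP: s01.
have s0 : 0 <= sup S by case/andP: s01.
have [d d0 sd] := dphi _ s0 s1.
pose h := Num.min (d / 2) (1 - sup S).
have h0 : 0 < h by rewrite lt_min divr_gt0// subr_gt0.
have hd : h < d by rewrite gt_min ltr_pdivrMr// ltr_pMr// ltr1n.
have h1 : h <= 1 - sup S by rewrite ge_min lexx orbT.
have : S (sup S + h).
  split=> /=; first by lra.
  by have := sd h h0 hd; lra.
by move=> /(ub_le_sup supS.2); lra.
Qed.

End dini.

Section upper_right.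
Context {R : realType} {X : normedModType R}.

Lemma upper_right_derivative_lt (phi : X -> R) x v (m : R) :
  (upper_right_derivative phi x v < m%:E)%E ->
  exists2 d : R, 0 < d & forall s, 0 < s -> s < d ->
    phi (x + s *: v) <= phi x + m * s.
Proof.
move=> /ereal_inf_lt[_ [V /nbhs_ballP[d /= d0 dV] <-] Vm].
exists d => // s s0 sd; rewrite -lerBlDl -ler_pdivrMr// -lee_fin.
apply: le_trans (ltW Vm); apply: ereal_sup_ubound; exists s => //.
by apply: dV => //; rewrite -ball_normE /= sub0r normrN gtr0_norm.
Qed.

End upper_right.

Section isomorphism_bound.
Context {R : realType} {X Y : normedModType R}.

(* Applied to [v = u* o T^-1], where [u*] norms [u], the bound on
   [surj_modulus T] says that [T^-1] has norm at most [c^-1] at [T u]. *)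
Lemma isomorphism_lower_bound (T : X -> Y) (c : R) (u : X) : isomorphism T ->
  0 < c -> (c%:E <= surj_modulus T)%E -> c * `|u| <= `|T u|.
Proof.
move=> [[lT oT] [S [[lS oS] TS ST]]] c0 cT.
have [->|u0] := eqVneq u 0; first by rewrite normr0 mulr0.
have nu : 0 < `|u| by rewrite normr_gt0.
have [w lw [w1 wu]] := norming_functional u.
pose v0 : Y -> R^o := w \o S.
have lv0 : linear v0 by move=> k a b; rewrite /v0 /= lS lw.
have ov0 : (opnorm v0 < +oo)%E.
  have [k k0 kS] := opnorm_fin oS.
  apply: (@le_lt_trans _ _ k%:E); last by rewrite ltry.
  apply: opnorm_le => // y; apply: le_trans (w1 _) _.
  by apply: le_opnorm; rewrite ?kS.
have [K K0 v0K] := opnorm_fin ov0.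
have v0_le y : `|v0 y| <= K * `|y| by apply: le_opnorm; rewrite ?v0K.
have v0u : v0 (T u) = `|u| by rewrite /v0 /= TS.
have uK : `|u| <= K * `|T u| by rewrite -v0u (le_trans (ler_norm _)).
have {}K0 : 0 < K.
  rewrite lt_neqAle K0 andbT; apply/eqP => K00.
  by move: uK; rewrite -K00 mul0r leNgt nu.
(* Division by the norm [K] of [v0] makes [v] admissible in the infimum defining [surj_modulus],
   which then yields [c <= K^-1]. *)
pose v : Y -> R^o := fun y => K^-1 * v0 y.
have lv : linear v by move=> k a b; rewrite /v lv0 mulrDr mulrCA.
have vo : opnorm v = 1%E.
  have v1 : (opnorm v <= 1%:E)%E.
    apply: opnorm_le => // y; rewrite normrM gtr0_norm ?invr_gt0// mul1r.
    by rewrite ler_pdivrMl.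
  apply/eqP; rewrite eq_le v1/=.
  have [k k0 kv] := opnorm_fin (le_lt_trans v1 (ltry _)).
  rewrite kv lee_fin -(ler_pM2l K0) mulr1 -lee_fin -v0K.
  apply: opnorm_le => [y|]; last by rewrite mulr_ge0// ltW.
  rewrite -mulrA -ler_pdivrMl//.
  have := @le_opnorm _ _ _ v k y lv; rewrite kv lexx => /(_ isT).
  by rewrite normrM gtr0_norm ?invr_gt0.
have : (c%:E <= opnorm (v \o T : X -> R^o))%E.
  apply: le_trans cT _; apply: ereal_inf_lbound; exists v => //.
  by split=> //; split=> //; rewrite vo ltry.
move=> /le_trans /(_ (_ : _ <= K^-1%:E)%E); rewrite lee_fin => cK.
have {}cK : c <= K^-1.
  apply: cK; apply: opnorm_le; last by rewrite invr_ge0 ltW.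
  move=> a /=; rewrite /v /v0 /= TS normrM gtr0_norm ?invr_gt0//.
  by rewrite ler_pM2l ?invr_gt0.
apply: (@le_trans _ _ (c * (K * `|T u|))); first by rewrite ler_pM2l.
have cK1 : c * K <= 1 by rewrite -ler_pdivlMr// div1r.
by rewrite mulrA ler_piMl.
Qed.

End isomorphism_bound.

Lemma nonexpansive_continuous {R : realType} {X Y : normedModType R}
  (f : X -> Y) : (forall x y, `|f x - f y| <= `|x - y|) -> continuous f.
Proof.
move=> f1 x; apply/cvgrPdist_lt => e e0; apply/nbhs_ballP; exists e => // y.
by rewrite -ball_normE /= => xy; apply: le_lt_trans (f1 _ _) xy.
Qed.

Section local_inverse.
Context {R : realType} {X Y : normedModType R}.
Variables (f : X -> Y) (Jf : X -> set (X -> Y)).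

Lemma ball_segment (x0 x x' : X) (r t : R) : `|x - x0| < r -> `|x' - x0| < r ->
  0 <= t -> t <= 1 -> `|x' + t *: (x - x') - x0| < r.
Proof.
move=> xr xr' t0 t1.
have -> : x' + t *: (x - x') - x0 = (1 - t) *: (x' - x0) + t *: (x - x0).
  rewrite scalerBl scale1r -[RHS]addrA [- _ + _]addrC -scalerBr opprB.
  by rewrite [x - x0 + _]addrA subrK addrAC.
apply: le_lt_trans (ler_normD _ _) _; rewrite !normrZ !ger0_norm ?subr_ge0//.
move: t0; rewrite le_eqVlt => /predU1P[<-|t0].
  by rewrite subr0 mul1r mul0r addr0.
have : t * `|x - x0| < t * r by rewrite ltr_pM2l.
have : (1 - t) * `|x' - x0| <= (1 - t) * r.
  by rewrite ler_wpM2l ?subr_ge0//; exact: ltW.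
lra.
Qed.

(** The values [T (x - x')] form a convex set. If it stayed at distance [e] from [f x - f x'], a
    separating functional [w] would make [w \o f] grow too slowly along the segment from [x'] to
    [x]. *)
Lemma mean_value (x0 x x' : X) (r e : R) : pseudo_jacobian f Jf ->
  (forall T, conv_hull_ball Jf x0 r T -> linear T) ->
  `|x - x0| < r -> `|x' - x0| < r -> 0 < e ->
  exists2 T, conv_hull_ball Jf x0 r T & `|T (x - x') - (f x - f x')| < e.
Proof.
move=> Jpseudo linJ xr xr' e0; apply: contrapT => noT.
have ball0 z : `|z - x0| < r -> Jf z `<=` conv_hull_ball Jf x0 r.
  move=> zr T zT; apply: sub_conv_hull; exists z => //.
  by rewrite -ball_normE /= distrC.
pose A := [set T (x - x') | T in conv_hull_ball Jf x0 r].
have [_ [T0 JT0] _ _] := Jpseudo x.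
have [|_ _ s t [S JS <-] [T JT <-] s0 t0 st1|_ [T JT <-]|w lw [w1 wA]] :=
    @separation _ _ A (f x - f x') e.
- by exists (T0 (x - x')), T0 => //; apply: ball0 JT0.
- by exists (s *: S + t *: T) => //; apply: conv_hull_combination.
- by rewrite leNgt; apply/negP => Te; apply: noT; exists T.
pose phi t := w (f (x' + t *: (x - x'))).
have dw : dual w.
  split=> //; apply: (@le_lt_trans _ _ 1%:E); last by rewrite ltry.
  by apply: opnorm_le => // u; rewrite mul1r.
have [cf _ _ _] := Jpseudo x.
have cphi : continuous (phi : R -> R^o).
  move=> t; have cw : continuous w.
    by apply: nonexpansive_continuous => a b; rewrite -(linear_subE lw).
  have cl : {for t, continuous (fun t : R => x' + t *: (x - x'))}.
    by apply: cvgD; [exact: cvg_cst|apply: cvgZr_tmp; exact: cvg_id].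
  have cfl := continuous_comp cl (cf _).
  exact: (continuous_comp cfl (cw _)).
(* Half of [e] is given up: the upper limit must be strictly below the slope for the bound to hold
   on a whole interval. *)
have := @dini_increment_le _ phi (w (f x - f x') - e / 2) cphi.
rewrite /phi scale1r scale0r addr0 subrKC (linear_subE lw).
suff h : forall t, 0 <= t -> t < 1 -> exists2 d : R, 0 < d & forall s, 0 < s ->
  s < d -> phi (t + s) <= phi t + (w (f x - f x') - e / 2) * s.
  by move=> /(_ _); move: h; rewrite (linear_subE lw) => h /(_ h); lra.
move=> t t0 t1.
have pr : `|x' + t *: (x - x') - x0| < r by apply: ball_segment => //; exact: ltW.
have [_ _ _ /(_ w (x - x') dw) pd] := Jpseudo (x' + t *: (x - x')).
have [|d d0 dphi] := @upper_right_derivative_lt _ _ (w \o f)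
    (x' + t *: (x - x')) (x - x') (w (f x - f x') - e / 2).
  apply: le_lt_trans pd _; apply: (@le_lt_trans _ _ (w (f x - f x') - e)%:E).
    apply: ge_ereal_sup => _ [T JT <-]; rewrite lee_fin lerBrDr; apply: wA.
    by exists T => //; apply: ball0 JT.
  by rewrite lte_fin; lra.
exists d => // s s0 sd; have := dphi s s0 sd.
by rewrite /phi /= scalerDl addrA.
Qed.

Lemma sur_bound_expanding x0 (r c : R) x x' : pseudo_jacobian f Jf -> 0 < c ->
  sur_bound Jf x0 r c -> `|x - x0| < r -> `|x' - x0| < r ->
  c * `|x - x'| <= `|f x - f x'|.
Proof.
move=> Jpseudo c0 sb xr xr'; apply/ler_addgt0Pr => e e0.
have [|T JT Te] := mean_value Jpseudo _ xr xr' e0.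
  by move=> T /sb[[[]]].
have [isoT cT] := sb T JT.
apply: le_trans (isomorphism_lower_bound _ isoT c0 cT) _.
rewrite -lerBlDl; apply: le_trans (ltW Te).
exact: le_trans (lerB_dist _ _) _.
Qed.

End local_inverse.

(** * Local surjectivity *)

Section local_surjectivity.
Context {R : realType} {X : completeNormedModType R} {Y : normedModType R}.
Variables (f : X -> Y) (Jf : X -> set (X -> Y)).

(** The Ekeland point of [dist_fun f y] started at [x] stays within [d] of [x], since the initial
    value is below [e * d]. If [f] missed [y] there, steepness would contradict minimality. *)
Lemma sur_bound_onto x0 (r c e d : R) x y : strong_chain_rule f Jf ->
  sur_bound Jf x0 r c -> 0 < e -> e < c -> `|x - x0| + d <= r ->
  `|f x - y| < e * d -> exists2 x1, `|x1 - x| < d & f x1 = y.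
Proof.
move=> chain sb e0 ec xdr fxy.
have lF := dist_fun_lipschitz y chain.1.
have F0 z : setT z -> 0 <= dist_fun f y z by move=> _; apply: normr_ge0.
have [x1 [_ Fx1 min1]] := ekeland e0 closedT
  (locally_lipschitz_continuous lF) F0 (I : setT x).
have x1d : `|x1 - x| < d.
  rewrite -(ltr_pM2l e0); apply: le_lt_trans fxy; apply: le_trans Fx1.
  by rewrite lerDr normr_ge0.
exists x1 => //; apply: contrapT => fx1.
have x1r : `|x1 - x0| < r.
  apply: lt_le_trans xdr; apply: le_lt_trans (ler_distD x _ _) _.
  by rewrite addrC ltrD2l.
have yfx1 : y != f x1 by apply/eqP => yfx; apply: fx1.
have st := steep_dist_fun chain sb x1r yfx1 (ltW e0) ec.
have [z [zx1 _ Fz]] := steep_descent ltr01 st.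
by move: zx1; rewrite (min1 z I Fz) eqxx.
Qed.

End local_surjectivity.

(** * The weighted Palais-Smale condition *)

Section weight_primitive.
Context {R : realType}.
Variable h : R -> R.
Hypothesis wh : weight h.

Let mu := @lebesgue_measure R.
Let gr (t : R) : R := (1 + h t)^-1.
Let g (t : R) : \bar R := (gr t)%:E.
Let H (t : R) : \bar R := (\int[mu]_(x in `[0%R, t]) g x)%E.

Let h_pos (t : R) : 0 <= t -> 0 < 1 + h t.
Proof. by move=> t0; case: wh => _ _ h0 _; rewrite ltr_wpDr// h0. Qed.

Let g_ge0 (t : R) : 0 <= t -> (0 <= g t)%E.
Proof. by move=> t0; rewrite lee_fin invr_ge0 ltW// h_pos. Qed.

Let mgS (A : set R) : measurable A -> A `<=` `[0, +oo[ -> measurable_fun A gr.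
Proof.
move=> mA A0.
(* Freezing the argument at [0] on the negative axis makes the integrand monotone on the whole line,
   hence measurable. *)
apply: (@eq_measurable_fun _ _ R R _ (fun t : R => (1 + h (Num.max 0 t))^-1)).
  move=> t /set_mem/A0 /=; rewrite in_itv/= andbT => t0.
  by rewrite max_r.
apply: nonincreasing_measurable => // s t st.
have m0 (x : R) : 0 <= Num.max 0 x by rewrite le_max lexx.
rewrite lef_pV2 ?posrE ?h_pos// lerD2l.
by case: wh => _ h_nd _ _; apply: h_nd => //; rewrite ge_max m0 le_max st orbT.
Qed.

Let g_integral (s t : R) : 0 <= s -> s <= t ->
  (0 <= \int[mu]_(x in `]s, t]) g x <= ((t - s) / (1 + h s))%:E)%E.
Proof.
move=> s0 st; have sub : `]s, t] `<=` `[0%R, +oo[.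
  move=> x /=; rewrite !in_itv/= => /andP[sx _].
  by rewrite andbT (le_trans s0)// ltW.
have pos x : `]s, t]%classic x -> (0 <= g x)%E.
  by move=> /sub /=; rewrite in_itv/= andbT; apply: g_ge0.
rewrite integral_ge0//=.
apply: (@le_trans _ _ (\int[mu]_(x in `]s, t]) (cst ((1 + h s)^-1)%:E x))%E).
  apply: ge0_le_integral; first exact: measurable_itv.
  - exact: pos.
  - by apply/measurable_EFinP; apply: mgS.
  - exact: measurable_cst.
  - move=> x /=; rewrite in_itv/= => /andP[sx _]; rewrite lee_fin.
    have x0 : 0 <= x by rewrite (le_trans s0)// ltW.
    rewrite lef_pV2 ?posrE ?h_pos// lerD2l.
    by case: wh => _ h_nd _ _; apply: h_nd => //; exact: ltW.
rewrite integral_cst; last exact: measurable_itv.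
rewrite -[X in (_ * X)%E]/(lebesgue_measure `]s, t]%classic).
rewrite lebesgue_measure_itv/= lte_fin; case: ltP => [st'|ts].
  by rewrite -EFinB -EFinM lee_fin mulrC.
by rewrite mule0 lee_fin divr_ge0 ?subr_ge0// ltW// h_pos.
Qed.

Let H_add (s t : R) : 0 <= s -> s <= t ->
  H t = (H s + \int[mu]_(x in `]s, t]) g x)%E.
Proof.
move=> s0 st; rewrite /H.
have -> : `[0%R, t]%classic = `[0%R, s] `|` `]s, t] :> set R.
  apply/seteqP; split=> x /=; rewrite !in_itv/=.
    by move=> /andP[-> ->]; rewrite andbT; case: (leP x s); [left|right].
  move=> [/andP[-> xs]|/andP[sx ->]]; rewrite ?(le_trans xs)// andbT.
  by rewrite (le_trans s0)// ltW.
have sub : `[0%R, s] `|` `]s, t] `<=` `[0%R, +oo[.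
  move=> x /= [|]; rewrite !in_itv/= andbT => /andP[]// sx _.
  by rewrite (le_trans s0)// ltW.
rewrite ge0_integral_setU//.
- apply/measurable_EFinP; apply: mgS => //; apply: measurableU; exact: measurable_itv.
- by move=> x /sub /=; rewrite in_itv/= andbT; apply: g_ge0.
- apply/disj_setPS => x /= []; rewrite !in_itv/= => /andP[_ xs] /andP[sx _].
  by move: xs; rewrite leNgt sx.
Qed.

Let H0 : H 0 = 0%E.
Proof. by rewrite /H set_itv1 integral_set1. Qed.

Let H_fin (t : R) : 0 <= t -> H t \is a fin_num.
Proof.
move=> t0; have := H_add (lexx 0) t0; rewrite H0 add0e => ->.
have /andP[? le] := g_integral (lexx 0) t0.
by rewrite ge0_fin_numE// (le_lt_trans le)// ltry.
Qed.

(** [G t] is the integral of [1 / (1 + h)] over [[0, t]]. The integrand is nonincreasing, so its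
    value at the left end bounds the increments; divergence of the integral makes [G] unbounded. *)
Lemma weight_primitive : exists G : R -> R,
  (forall s t, 0 <= s -> s <= t -> 0 <= G t - G s <= (t - s) / (1 + h s)) /\
  forall M, exists2 s, 0 <= s & M < G s.
Proof.
exists (fun t => fine (H t)); split=> [s t s0 st|M].
  have t0 := le_trans s0 st.
  have := g_integral s0 st.
  have -> : (\int[mu]_(x in `]s, t]) g x = (fine (H t) - fine (H s))%:E)%E.
    rewrite EFinB !fineK ?H_fin// (H_add s0 st) addeAC subee ?add0e ?H_fin//.
  by rewrite !lee_fin.
have cvH : (H n%:R @[n --> \oo] --> (+oo : \bar R))%E.
  case: wh => _ _ _ <-.
  have -> : `[0%R, +oo[%classic = \bigcup_n `[0%R, n%:R]%classic :> set R.
    rewrite itv_bndy_bigcup_BRight; apply: eq_bigcupr => n _.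
    by rewrite add0r.
  have sub (n : nat) : (`[0, n%:R]%classic : set R) `<=` `[0, +oo[%classic.
    by move=> x /=; rewrite !in_itv/= => /andP[->].
  apply: ge0_nondecreasing_set_cvg_integral.
  - move=> m n mn; apply/subsetPset => x /=; rewrite !in_itv/= => /andP[-> xm].
    by rewrite (le_trans xm)// ler_nat.
  - by move=> n; exact: measurable_itv.
  - move=> n; apply/measurable_EFinP; apply: mgS; last exact: sub.
    exact: measurable_itv.
  - by move=> n x /sub /=; rewrite in_itv/= andbT; apply: g_ge0.
move/cvgeyPgt: cvH => /(_ M)[n _ /(_ n (leqnn n))] /= MH.
by exists n%:R; rewrite ?ler0n// -lte_fin fineK// H_fin.
Qed.

End weight_primitive.

(** * Coercivity and uniform steepness *)

Section palais_smale.
Context {R : realType} {X : completeNormedModType R}.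
Variables (F : X -> R^o) (h : R -> R).
Hypothesis lF : locally_lipschitz F.
Hypothesis F_ge0 : forall x, 0 <= F x.
Hypothesis wh : weight h.
Hypothesis PS : weighted_chang_PS F h.

Let h_pos (t : R) : 0 <= t -> 0 < 1 + h t.
Proof. by move=> t0; case: wh => _ _ h0 _; rewrite ltr_wpDr// h0. Qed.

Lemma PS_subsequence (M c : R) (u : nat -> X) : (forall n, F (u n) <= M) ->
  (forall n, exists2 w : X -> R^o, clarke_subdiff F (u n) w &
     (opnorm w <= (c / n.+1%:R / (1 + h `|u n|))%:E)%E) ->
  exists (k : nat -> nat) (l : X),
    {homo k : m n / (m < n)%N} /\ u (k n) @[n --> \oo] --> l.
Proof.
move=> FM uw; apply: PS; first by exists M => n; rewrite ger0_norm.
have bound n : (0 <= min_slope F (u n) * (1 + h `|u n|)%:E <=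
    (c * harmonic n)%:E)%E.
  have [w wF wle] := uw n; have hn := h_pos (normr_ge0 (u n)).
  have sl0 : (0 <= min_slope F (u n))%E.
    by apply: le_ereal_inf_tmp => _ [v _ <-]; exact: opnorm_ge0.
  rewrite mule_ge0//= ?lee_fin; last exact: ltW.
  rewrite -lee_pdivlMr//; apply: le_trans wle.
  by apply: ereal_inf_lbound; exists w.
apply: (squeeze_cvge _ (cvg_cst 0%E)).
  by apply: nearW => n; exact: bound.
apply: cvg_EFin; first exact: nearW.
rewrite -[X in _ --> X](mulr0 c).
by apply: cvgM; [exact: cvg_cst|exact: cvg_harmonic].
Qed.

(** A lower estimate based at [x] alone suffices, because a Clarke bound applies in particular to
    the base point [x]. *)
Let slope_subdiff (x : X) (e d : R) : 0 <= e -> 0 < d ->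
  (forall z, `|z - x| < d -> F x - e * `|z - x| <= F z) ->
  exists2 w : X -> R^o, clarke_subdiff F x w & (opnorm w <= e%:E)%E.
Proof.
move=> e0 d0 Fx; apply: clarke_subdiff_le => // v a [r r0 Fa].
have nv : 0 < 1 + `|v| by rewrite ltr_pwDl.
pose t := Num.min (r / 2) (d / 2 / (1 + `|v|)).
have t0 : 0 < t by rewrite lt_min !divr_gt0.
have tr : t < r by rewrite gt_min ltr_pdivrMr// ltr_pMr// ltr1n.
have td : t * `|v| < d.
  apply: (@le_lt_trans _ _ (t * (1 + `|v|))); first by rewrite ler_pM2l// lerDr.
  rewrite -ltr_pdivlMr// gt_min; apply/orP; right.
  by rewrite ltr_pM2r ?invr_gt0// ltr_pdivrMr// ltr_pMr// ltr1n.
have := Fa x t; rewrite subrr normr0 => /(_ r0 t0 tr) Fxt.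
have := Fx (x + t *: v); rewrite addrAC subrr add0r normrZ gtr0_norm//.
move=> /(_ td) Fx'; have := le_trans Fx' Fxt.
by rewrite lerD2l mulrCA -mulrN [a * t]mulrC ler_pM2l.
Qed.

(* Ekeland's principle is applied to [F] plus [e] times the distance, measured
   by the primitive [G] of [1 / (1 + h)], to a point [x0] so far away that the
   penalty exceeds [M] on the ball of radius [r]. *)
Let almost_critical (M r e : R) : 0 <= r -> 0 < e ->
  (forall K, exists2 x, F x <= M & K < `|x|) ->
  exists x, [/\ F x <= M, r < `|x| & exists2 w : X -> R^o,
    clarke_subdiff F x w & (opnorm w <= (3 * e / (1 + h `|x|))%:E)%E].
Proof.
move=> r0 e0 unb; have [G [GH Goo]] := weight_primitive wh.
have G_nd s t : 0 <= s -> s <= t -> G s <= G t.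
  by move=> s0 st; have /andP[] := GH s t s0 st; rewrite subr_ge0.
have GL s t : 0 <= s -> s <= t -> `|G t - G s| <= (t - s) / (1 + h s).
  by move=> s0 st; have /andP[p q] := GH s t s0 st; rewrite ger0_norm.
have GL1 s t : 0 <= s -> 0 <= t -> `|G t - G s| <= `|t - s|.
  wlog st : s t / s <= t => [wl s0 t0|s0 t0].
    have [st|/ltW ts] := leP s t; first exact: wl.
    by rewrite distrC [leRHS]distrC wl.
  apply: le_trans (GL _ _ s0 st) _; rewrite (ger0_norm (_ : 0 <= t - s)) ?subr_ge0//.
  rewrite ler_pdivrMr ?h_pos// ler_peMr ?subr_ge0// lerDl.
  by case: wh => _ _ + _; apply.
(* Since [|x0|] exceeds [S], a point whose value of [G] is within [M / e] of that of [x0] has norm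
   larger than [r]. *)
have [S S0 GS] := Goo (G r + M / e).
have [x0 Fx0 x0S] := unb S.
(* [K] bounds the norm of the future Ekeland point [x1], so the parameter [e / (1 + h K)], which
   must be fixed beforehand, is at most [e / (1 + h |x1|)]. *)
have [K K0 GK] := Goo (G `|x0| + M / e).
pose P (x : X) : R^o := F x + e * `|G `|x| - G `|x0| |.
have cP : continuous P.
  have cG : continuous (fun x : X => G `|x| : R^o).
    apply: nonexpansive_continuous => x z.
    exact: le_trans (GL1 _ _ (normr_ge0 _) (normr_ge0 _)) (ler_dist_dist _ _).
  move=> x; apply: cvgD; first exact: locally_lipschitz_continuous.
  apply: cvgM; first exact: cvg_cst.
  by apply: cvg_norm; apply: cvgB; [exact: cG|exact: cvg_cst].
have P0 x : setT x -> 0 <= P x.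
  by move=> _; rewrite addr_ge0// mulr_ge0// ltW.
have eta0 : 0 < e / (1 + h K) by rewrite divr_gt0// h_pos.
have [x1 [_ Px1 min1]] := ekeland eta0 closedT cP P0 (I : setT x0).
have {}Px1 : F x1 + e * `|G `|x1| - G `|x0| | <= M.
  apply: le_trans Fx0; move: Px1; rewrite /P subrr normr0 mulr0 addr0.
  by apply: le_trans; rewrite lerDl mulr_ge0// ltW.
have Fx1 : F x1 <= M.
  by apply: le_trans Px1; rewrite lerDl mulr_ge0// ltW.
have Gx1 : `|G `|x1| - G `|x0| | <= M / e.
  by rewrite ler_pdivlMr// mulrC; have := F_ge0 x1; lra.
have {Gx1}/andP[Gx1l Gx1u] : - (M / e) <= G `|x1| - G `|x0| <= M / e.
  by rewrite -ler_norml.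
have rx1 : r < `|x1|.
  rewrite ltNge; apply/negP => /(G_nd _ _ (normr_ge0 _)).
  have := G_nd _ _ S0 (ltW x0S); lra.
have x1K : `|x1| <= K.
  by rewrite leNgt; apply/negP => /ltW/(G_nd _ _ K0); lra.
exists x1; split=> //; set s := `|x1| in rx1 x1K *.
have s0 : 0 < s by apply: le_lt_trans rx1.
have hs : 0 < 1 + h s by apply/h_pos/ltW.
(* When [|z|] is below [s], the increment of [G] is controlled by [h] at [|z|]. Continuity of [h] at
   [s] converts this at the price of a factor 2; the Ekeland term brings the total to 3. *)
have [d d0 hd] : exists2 d : R, 0 < d & forall t, `|t - s| < d -> 0 <= t ->
    (1 + h s) / 2 <= 1 + h t.
  have [/continuous_within_itvcyP[ch _] _ _ _] := wh.
  have /ch : s \in `]0, +oo[ by rewrite in_itv/= s0.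
  move=> /cvgrPdist_lt /(_ _ (divr_gt0 hs (ltr0Sn R 1)))/nbhs_ballP[d /= d0 hd].
  exists d => // t ts t0; have : ball s d t by rewrite -ball_normE /= distrC.
  by move=> /hd /=; rewrite ltr_norml => /andP[_]; lra.
apply: (@slope_subdiff _ _ d) => // [|z zd].
  by rewrite divr_ge0 ?(ltW hs)// mulr_ge0// ltW.
have Gz : `|G `|z| - G s| <= 2 * `|z - x1| / (1 + h s).
  have az : `| `|z| - s| <= `|z - x1| by exact: ler_dist_dist.
  have [sz|/ltW zs] := leP s `|z|.
    apply: le_trans (GL _ _ (ltW s0) sz) _; rewrite ler_pM2r ?invr_gt0//.
    move: az; rewrite ger0_norm ?subr_ge0//; have := normr_ge0 (z - x1); lra.
  rewrite distrC; apply: le_trans (GL _ _ (normr_ge0 _) zs) _.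
  have hz := hd `|z| (le_lt_trans az zd) (normr_ge0 _).
  rewrite ler_pdivrMr ?h_pos// mulrAC ler_pdivlMr//.
  move: az; rewrite distrC ger0_norm ?subr_ge0// => az.
  apply: (@le_trans _ _ (`|z - x1| * (1 + h s))); first by rewrite ler_pM2r.
  have : `|z - x1| * ((1 + h s) / 2) <= `|z - x1| * (1 + h `|z|) by rewrite ler_wpM2l.
  lra.
have : P x1 <= P z + e / (1 + h K) * `|z - x1|.
  rewrite leNgt; apply/negP => Pz; have /(_ (ltW Pz)) zx := min1 z I.
  by move: Pz; rewrite zx subrr normr0 mulr0 addr0 ltxx.
have : e / (1 + h K) * `|z - x1| <= e / (1 + h s) * `|z - x1|.
  have hsK : h s <= h K by case: wh => _ + _ _; apply => //; exact: ltW.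
  rewrite ler_wpM2r// ler_wpM2l ?(ltW e0)// lef_pV2 ?posrE//; last exact: h_pos.
  by rewrite lerD2l.
have : e * `|G `|z| - G `|x0| | <=
    e * `|G s - G `|x0| | + e * (2 * `|z - x1| / (1 + h s)).
  rewrite -mulrDr ler_pM2l//; apply: le_trans (ler_distD (G s) _ _) _.
  by rewrite [leRHS]addrC lerD2r.
rewrite /P -/s; have -> : 3 * e / (1 + h s) * `|z - x1| =
  e * (2 * `|z - x1| / (1 + h s)) + e / (1 + h s) * `|z - x1| by ring.
lra.
Qed.

(** On an unbounded sublevel set, [almost_critical] gives points of norm above [n] with weighted
    slope of order [1 / n]. A convergent subsequence of them is impossible. *)
Lemma PS_coercive (M : R) : exists K : R, forall x, F x <= M -> `|x| <= K.
Proof.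
apply: contrapT => nK.
have unb K : exists2 x, F x <= M & K < `|x|.
  apply: contrapT => nx; apply: nK; exists K => x FxM.
  by rewrite leNgt; apply/negP => Kx; apply: nx; exists x.
have H (n : nat) : exists x, [/\ F x <= M, n%:R < `|x| & exists2 w : X -> R^o,
    clarke_subdiff F x w & (opnorm w <= (3 / n.+1%:R / (1 + h `|x|))%:E)%E].
  by apply: almost_critical => //; rewrite ?invr_gt0 ?ler0n ?ltr0n.
have [u uP] := choice H.
have [|n|k [l [k_incr ukl]]] := @PS_subsequence M 3 u.
- by move=> n; case: (uP n).
- by case: (uP n).
have kn n : (n <= k n)%N.
  by elim: n => // n IH; apply: leq_ltn_trans IH (k_incr _ _ (ltnSn n)).
move/cvgrPdist_lt: ukl => /(_ 1 ltr01)[n0 _ ln].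
pose n := maxn n0 (Num.truncn (`|l| + 1)).+1.
have := ln n (leq_maxl _ _); have [_ kx _] := uP (k n).
have : `|l| + 1 < n%:R.
  apply: lt_le_trans (truncnS_gt _) _.
  by rewrite ler_nat leq_maxr.
have : (n%:R : R) <= (k n)%:R by rewrite ler_nat.
move=> nk ln1 /=; have := ler_distD l (u (k n)) 0; rewrite !subr0 distrC; lra.
Qed.

(** Otherwise there are points outside [N] with slopes tending to [0]. Coercivity bounds the weight
    along them, so they accumulate at a point outside [N], near which steepness holds at a fixed
    rate. *)
Lemma uniform_steep (N : set X) (M : R) : open N ->
  (forall x, ~ N x -> exists2 e : R, 0 < e & steep F e x) ->
  exists2 e : R, 0 < e & forall x, F x <= M -> ~ N x -> steep F e x.
Proof.
move=> oN stN; apply: contrapT => nst.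
have H (n : nat) : exists x, [/\ F x <= M, ~ N x & ~ steep F n.+1%:R^-1 x].
  apply: contrapT => nx; apply: nst; exists n.+1%:R^-1.
    by rewrite invr_gt0 ltr0n.
  by move=> x FM Nx; apply: contrapT => nsx; apply: nx; exists x.
have [u uP] := choice H; have [K uK] := PS_coercive M.
have K0 : 0 <= K by apply: le_trans (uK (u 0%N) _) => //; case: (uP 0%N).
have [|n|k [l [k_incr ukl]]] := @PS_subsequence M (1 + h K) u.
- by move=> n; case: (uP n).
- have [Fu _ nsu] := uP n.
  have [|w wF wle] := not_steep_subdiff lF _ nsu; first by rewrite invr_ge0 ler0n.
  exists w => //; apply: le_trans wle _; rewrite lee_fin.
  rewrite ler_pdivlMr ?h_pos// mulrC ler_pM2r ?invr_gt0 ?ltr0n// lerD2l.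
  by case: wh => _ + _ _; apply => //; apply: uK.
have kn n : (n <= k n)%N.
  by elim: n => // n IH; apply: leq_ltn_trans IH (k_incr _ _ (ltnSn n)).
have Nl : ~ N l.
  have cN : closed (~` N) by apply: open_closedC.
  by apply: (closed_cvg (~` N) cN _ _ ukl); apply: nearW => n; case: (uP (k n)).
have [e e0 ste] := stN l Nl.
have /ukl[n0 _ stn] : nbhs l [set x | steep F e x].
  by apply: open_nbhs_nbhs; split=> //; exact: steep_open.
pose n := maxn n0 (Num.truncn e^-1).+1.
have [_ _] := uP (k n); apply; apply: steep_le (stn n (leq_maxl _ _)).
rewrite -[e]invrK lef_pV2 ?posrE ?invr_gt0 ?ltr0n//.
apply: le_trans (ltW (truncnS_gt _)) _; rewrite ler_nat.
apply: leq_trans (leq_maxr n0 _) _; apply: leq_trans (kn n) _.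
exact: leqnSn.
Qed.

End palais_smale.

(** * Basins of attraction *)

Section basins.
Context {R : realType} {X : completeNormedModType R}.
Variable F : X -> R^o.
Hypothesis cF : continuous F.
Hypothesis F_ge0 : forall x, 0 <= F x.

Lemma near_lt (x : X) (a : R) : F x < a -> \forall z \near x, F z < a.
Proof.
move=> Fx; have /cvgrPdist_lt/(_ (a - F x)) := @cF x.
rewrite subr_gt0 => /(_ Fx); apply: filterS => z.
by rewrite distrC ltr_norml => /andP[_]; lra.
Qed.

Lemma segment_continuous (x u : X) : continuous (fun t : R => x + t *: u).
Proof.
by move=> t; apply: cvgD; [exact: cvg_cst|apply: cvgZr_tmp; exact: cvg_id].
Qed.

Lemma segment_crossing (a x u : X) (d : R) : `|x - a| <= d -> d <= `|x + u - a| ->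
  exists s : R, [/\ 0 <= s, s <= 1 & `|x + s *: u - a| = d].
Proof.
move=> xd ud; pose g (s : R) : R := `|x + s *: u - a|.
have cg : continuous g.
  move=> s; apply: cvg_norm; apply: cvgB; last exact: cvg_cst.
  exact: segment_continuous.
have [|s] := @IVT R g 0 1 d ler01 (continuous_subspaceT cg).
  by rewrite /g scale0r addr0 scale1r ge_min xd le_max ud orbT.
by rewrite in_itv/= => /andP[s0 s1] gs; exists s.
Qed.

(* The factor 3 makes the wells of two distinct zeros disjoint. *)
Definition well (q x : X) : Prop := exists d c : R, [/\ 0 < d, 0 < c,
  forall z, `|z - q| <= 3 * d -> c * `|z - q| <= F z, `|x - q| < d & F x < c * d].

Definition in_well (x : X) : Prop := exists q, F q = 0 /\ well q x.

Lemma well_open q : open [set x | well q x].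
Proof.
rewrite openE => x [d [c [d0 c0 Fz xd Fx]]].
have cq : continuous (fun z : X => `|z - q| : R^o).
  by move=> z; apply: cvg_norm; apply: cvgB; [exact: cvg_id|exact: cvg_cst].
have n1 : \forall z \near x, `|z - q| < d.
  exact: (cvgr_lt _ (cq x)).
have n2 : \forall z \near x, F z < c * d.
  exact: near_lt.
by apply: filterS2 n1 n2 => z zd Fzd; exists d, c; split.
Qed.

Lemma in_well_open : open in_well.
Proof.
have -> : in_well = \bigcup_(q in [set q | F q = 0]) [set x | well q x].
  apply/seteqP; split=> x; first by move=> [q [Fq qx]]; exists q.
  by move=> [q Fq qx]; exists q.
by apply: bigcup_open => q _; exact: well_open.
Qed.

Lemma well_disjoint q r x : F q = 0 -> F r = 0 -> well q x -> well r x -> q = r.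
Proof.
move=> Fq Fr [d [c [d0 c0 Fd xd _]]] [d' [c' [d'0 c'0 Fd' xd' _]]].
have qr : `|q - r| < d + d'.
  by apply: le_lt_trans (ler_distD x _ _) _; rewrite ltrD// distrC.
apply/eqP; rewrite -subr_eq0 -normr_le0.
(* The other zero lies within twice the larger radius of its centre, where the linear lower bound of
   that well forces the distance to vanish. *)
have [dd|dd] := leP d' d.
  have := Fd r; rewrite Fr distrC pmulr_rle0//; apply; lra.
have := Fd' q; rewrite Fq pmulr_rle0//; apply; lra.
Qed.

(** * Descending polygonal paths *)

Section descent.
Variable e : R.
Hypothesis e0 : 0 < e.

(** Allowing all starting points near [x] makes basins open; comparing any two parameters [s <= t]
    allows a segment to be cut at an interior point. *)
Definition desc_step (x u : X) : Prop := exists2 d : R, 0 < d &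
  forall z, `|z - x| < d -> forall s t, 0 <= s -> s <= t -> t <= 1 ->
    F (z + t *: u) <= F (z + s *: u) - e * ((t - s) * `|u|).

Inductive reach (q : X) : X -> Prop :=
| reach_well x : well q x -> reach q x
| reach_step x u : desc_step x u -> reach q (x + u) -> reach q x.

Lemma steep_step x : steep F e x -> exists2 u, u != 0 & desc_step x u.
Proof.
move=> [v [r [v0 r0 Fv]]].
have k1 : 1 <= 1 + `|v| by rewrite lerDl.
have k0 : 0 < 1 + `|v| by apply: lt_le_trans k1.
(* With this scaling both the length of the step [a *: v] and the time [a] are at most [r / 2]. *)
pose a := r / 2 / (1 + `|v|).
have a0 : 0 < a by rewrite !divr_gt0.
have r2 : r / 2 < r by rewrite ltr_pdivrMr// ltr_pMr// ltr1n.
have ar : a * (1 + `|v|) = r / 2 by rewrite divfK// gt_eqF.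
have ar2 : a <= r / 2 by rewrite -ar ler_peMr// ltW.
have avr : a * `|v| <= r / 2 by rewrite -ar ler_pM2l// lerDr.
exists (a *: v); first by rewrite scaler_eq0 negb_or v0 gt_eqF.
exists (r / 2) => [|z zx s t s0 st t1]; first exact: divr_gt0.
move: st; rewrite le_eqVlt => /predU1P[<-|st].
  by rewrite subrr mul0r mulr0 subr0.
have -> : z + t *: (a *: v) = z + s *: (a *: v) + ((t - s) * a) *: v.
  by rewrite -addrA !scalerA -scalerDl -mulrDl subrKC.
have ts : 0 < t - s by rewrite subr_gt0.
rewrite normrZ gtr0_norm// mulrA; apply: Fv.
- rewrite addrAC; apply: le_lt_trans (ler_normD _ _) _.
  rewrite [r]splitr scalerA normrZ normrM (ger0_norm s0) (gtr0_norm a0) ltr_leD//.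
  by apply: le_trans avr; rewrite -mulrA ler_piMl// ?mulr_ge0 ?(ltW a0)//; lra.
- exact: mulr_gt0.
- by apply: le_lt_trans r2; apply: le_trans ar2; rewrite ler_piMl ?(ltW a0)//; lra.
Qed.

Lemma desc_step_le x u s : desc_step x u -> 0 <= s -> s <= 1 ->
  F (x + s *: u) <= F x - e * (s * `|u|).
Proof.
move=> [d d0 Fd] s0 s1; have := Fd x _ 0 s (lexx 0) s0 s1.
by rewrite scale0r addr0 !subr0 subrr normr0; apply.
Qed.

Lemma desc_step1 x u : desc_step x u -> F (x + u) <= F x - e * `|u|.
Proof. by move=> /desc_step_le /(_ ler01 (lexx 1)); rewrite scale1r mul1r. Qed.

Lemma desc_step_tail x u s : desc_step x u -> 0 <= s -> s <= 1 ->
  desc_step (x + s *: u) ((1 - s) *: u).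
Proof.
move=> [d d0 Fd] s0 s1; exists d => // z zx a b a0 ab b1.
have z'x : `|z - s *: u - x| < d by rewrite addrAC -addrA -opprD.
have s1' : 0 <= 1 - s by rewrite subr_ge0.
have E k : z - s *: u + (s + k * (1 - s)) *: u = z + k *: ((1 - s) *: u).
  by rewrite [in LHS]scalerDl addrA subrK scalerA.
have := Fd _ z'x (s + a * (1 - s)) (s + b * (1 - s)).
rewrite !E.
have -> : s + b * (1 - s) - (s + a * (1 - s)) = (b - a) * (1 - s) by ring.
rewrite normrZ (ger0_norm s1') mulrA; apply.
- by rewrite addr_ge0// mulr_ge0.
- by rewrite lerD2l ler_wpM2r.
- by rewrite -lerBrDl -[leRHS]mul1r ler_wpM2r.
Qed.

Lemma reach_near q x : reach q x -> \forall z \near x, reach q z.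
Proof.
elim=> {}x.
  move=> qx; have : nbhs x [set z | well q z].
    by apply: open_nbhs_nbhs; split=> //; exact: well_open.
  by apply: filterS => z; apply: reach_well.
move=> u [d d0 Fd] _ IH.
have n1 : \forall z \near x, `|z - x| < d / 2.
  apply/nbhs_ballP; exists (d / 2); first exact: divr_gt0.
  by move=> z; rewrite -ball_normE /= distrC.
have n2 : \forall z \near x, reach q (z + u).
  have : z + u @[z --> x] --> x + u by apply: cvgD; [exact: cvg_id|exact: cvg_cst].
  exact.
apply: filterS2 n1 n2 => z zx; apply: reach_step.
exists (d / 2); first exact: divr_gt0.
move=> y yz; apply: Fd; rewrite [d]splitr; apply: le_lt_trans (ler_distD z _ _) _.
exact: ltrD.
Qed.

Lemma reach_open q : open [set x | reach q x].
Proof. by rewrite openE => x; exact: reach_near. Qed.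

(* A descending path cannot cross the rim of a well. *)
Lemma reach_well_eq q r x : F q = 0 -> F r = 0 -> reach r x -> well q x -> q = r.
Proof.
move=> Fq Fr; elim=> {}x; first by move=> rx qx; exact: well_disjoint qx rx.
move=> u ux _ IH [d [c [d0 c0 Fd xd Fx]]]; apply: IH.
have xud : `|x + u - q| < d.
  rewrite ltNge; apply/negP => dxu.
  have [s [s0 s1 sd]] := segment_crossing (ltW xd) dxu.
  have := Fd (x + s *: u); rewrite sd => /(_ _) Fs.
  have : c * d <= F (x + s *: u) by apply: Fs; lra.
  apply/negP; rewrite -ltNge; apply: le_lt_trans (desc_step_le ux s0 s1) _.
  apply: le_lt_trans Fx; rewrite gerBl mulr_ge0 ?(ltW e0)// mulr_ge0//.
exists d, c; split=> //; apply: le_lt_trans (desc_step1 ux) _.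
by apply: le_lt_trans Fx; rewrite gerBl mulr_ge0 ?(ltW e0).
Qed.

(** The path from [x] to [q] must leave the ball, since a point of the ball in a well of [q] would
    force [q = r]. It is cut at the exit point; the remainder still leads to [q], and the part
    travelled has length at least [|x - z|]. *)
Lemma reach_exit q r x a (d : R) : F q = 0 -> F r = 0 -> q != r ->
  (forall z, `|z - a| <= d -> reach r z) -> reach q x -> `|x - a| <= d ->
  exists z, [/\ `|z - a| = d, reach q z & F z <= F x - e * `|x - z|].
Proof.
move=> Fq Fr qr ra; elim=> {}x.
  move=> qx xa; have := reach_well_eq Fq Fr (ra x xa) qx.
  by move=> /eqP; rewrite (negbTE qr).
move=> u ux qxu IH xa; have [xua|dxu] := leP `|x + u - a| d.
  have [z [za qz Fz]] := IH xua; exists z; split=> //.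
  have := desc_step1 ux; have := ler_distD (x + u) x z.
  rewrite opprD addrA subrr sub0r normrN -(ler_pM2l e0) mulrDr; lra.
have [s [s0 s1 sd]] := segment_crossing xa (ltW dxu).
exists (x + s *: u); split=> //.
  apply: reach_step (desc_step_tail ux s0 s1) _.
  by rewrite -addrA -scalerDl subrKC scale1r.
rewrite opprD addrA subrr sub0r normrN normrZ ger0_norm//.
exact: desc_step_le.
Qed.

Variable M : R.
Hypothesis stM : forall x, F x <= M -> ~ in_well x -> steep F e x.

(** An Ekeland point of the closed complement of all basins lies outside the wells, hence is steep;
    a descending step from it cannot enter a basin, against minimality. *)
Lemma reach_cover x0 : F x0 <= M -> exists q, F q = 0 /\ reach q x0.
Proof.
move=> Fx0; pose U := \bigcup_(q in [set q | F q = 0]) [set x | reach q x].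
have [[q Fq qx]|nU] := pselect (U x0); first by exists q.
have cU : closed (~` U).
  by apply: open_closedC; apply: bigcup_open => q _; exact: reach_open.
have [x1 [Ux1 Fx1 min1]] := ekeland e0 cU cF (fun x _ => F_ge0 x) nU.
have FM : F x1 <= M.
  by apply: le_trans Fx0; apply: le_trans Fx1; rewrite lerDl mulr_ge0// ltW.
have [|u u0 ux] := steep_step (stM FM _).
  by move=> [q [Fq qx1]]; apply: Ux1; exists q => //; exact: reach_well.
have /min1 : (~` U) (x1 + u).
  by move=> [q Fq qxu]; apply: Ux1; exists q => //; exact: reach_step qxu.
have -> : x1 + u - x1 = u by rewrite addrAC subrr add0r.
move=> xu; have : x1 + u = x1 by apply: xu; have := desc_step1 ux; lra.
move=> /eqP; rewrite -subr_eq0 addrAC subrr add0r => /eqP u00.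
by move: u0; rewrite u00 eqxx.
Qed.

(* At an Ekeland point [x1] of the closure of the set [B] of points that reach
   two zeros, a whole ball reaches the same zero [r]; a point of [B] near [x1]
   reaches another zero by a path which leaves this ball at a point of [B],
   after a definite decrease of [F]. *)
Lemma reach_unique a b x0 : F x0 <= M -> F a = 0 -> F b = 0 -> reach a x0 ->
  reach b x0 -> a = b.
Proof.
move=> Fx0 Fa Fb ax0 bx0; apply: contrapT => /eqP ab.
pose B := [set x | exists p q,
  [/\ F p = 0, F q = 0, p != q, reach p x & reach q x]].
have B0 : closure B x0 by apply: subset_closure; exists a, b.
(* Half the rate of descent leaves [e * k / 2] to absorb the two errors of size [e * k / 4] made in
   replacing [x1] by [x]. *)
have e2 : 0 < e / 2 by rewrite divr_gt0.
have [x1 [Bx1 Fx1 min1]] :=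
  ekeland e2 (@closed_closure _ B) cF (fun x _ => F_ge0 x) B0.
have FM : F x1 <= M.
  by apply: le_trans Fx0; apply: le_trans Fx1; rewrite lerDl mulr_ge0// ltW.
have [r [Fr /reach_near/nbhs_ballP[d /= d0 dr]]] := reach_cover FM.
pose k := d / 2; have k0 : 0 < k by rewrite divr_gt0.
have kr z : `|z - x1| <= k -> reach r z.
  move=> zk; apply: dr; rewrite -ball_normE /= distrC; apply: le_lt_trans zk _.
  by rewrite ltr_pdivrMr// ltr_pMr// ltr1n.
have ek : 0 < e * k by rewrite mulr_gt0.
have n1 : \forall z \near x1, `|z - x1| < k / 4.
  apply/nbhs_ballP; exists (k / 4); first exact: divr_gt0.
  by move=> z; rewrite -ball_normE /= distrC.
have n2 : \forall z \near x1, F z < F x1 + e * k / 4.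
  by apply: near_lt; rewrite ltrDl divr_gt0.
have [x [[p [q [Fp Fq pq px qx]]] [xx1 Fx]]] := Bx1 _ (filterI n1 n2).
have [s [Fs sr sx]] : exists s, [/\ F s = 0, s != r & reach s x].
  have [pr|pr] := eqVneq p r; last by exists p.
  by exists q; split=> //; rewrite -pr eq_sym.
have [|z [zk sz Fz]] := reach_exit Fs Fr sr kr sx.
  by apply: le_trans (ltW xx1) _; rewrite ler_pdivrMr// ler_peMr ?(ltW k0)// ler1n.
have /min1 : closure B z.
  by apply: subset_closure; exists s, r; split=> //; apply: kr; rewrite zk.
rewrite zk => /(_ _) zx1.
have : z = x1.
  apply: zx1; have := ler_distD x z x1; rewrite zk distrC -(ler_pM2l e0) mulrDr.
  have : e * `|x - x1| < e * (k / 4) by rewrite ltr_pM2l.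
  lra.
by move=> zx; move: zk; rewrite zx subrr normr0 => kk; move: k0; rewrite -kk ltxx.
Qed.

End descent.

Hypothesis st_unif : forall M : R, exists2 e : R, 0 < e &
  forall x, F x <= M -> ~ in_well x -> steep F e x.

Lemma exists_zero : exists q, F q = 0.
Proof.
have [e e0 st] := st_unif (F 0).
by have [q [Fq _]] := reach_cover e0 st (lexx _); exists q.
Qed.

Hypothesis well_zero : forall q, F q = 0 -> well q q.

(** On the segment from [p] to [q], the parameters in the basin of [p] form an open set, and also a
    closed one because the basins cover the segment and are disjoint. The descent rate is the one
    for the maximum of [F] on the segment. *)
Lemma unique_zero p q : F p = 0 -> F q = 0 -> p = q.
Proof.
move=> Fp Fq; pose g (t : R) := p + t *: (q - p).
have cg : continuous g := @segment_continuous p (q - p).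
have cFg : continuous (F \o g : R -> R^o).
  by move=> t; apply: (continuous_comp (@cg t)); exact: cF.
have [m _ gm] := EVT_max ler01 (continuous_subspaceT cFg).
have [e e0 st] := st_unif (F (g m)).
have cover t : 0 <= t -> t <= 1 -> exists r, F r = 0 /\ reach e r (g t).
  by move=> t0 t1; apply: (reach_cover e0 st); apply: gm; rewrite in_itv/= t0.
have uniq t a b : 0 <= t -> t <= 1 -> F a = 0 -> F b = 0 -> reach e a (g t) ->
    reach e b (g t) -> a = b.
  by move=> t0 t1; apply: (reach_unique e0 st); apply: gm; rewrite in_itv/= t0.
pose S := [set t : R | 0 <= t <= 1 /\ reach e p (g t)].
have S0 : S 0.
  split; first by rewrite lexx ler01.
  by apply: reach_well; rewrite /g scale0r addr0; exact: well_zero.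
have supS : has_sup S by split; [exists 0|exists 1 => t [/andP[]]].
have s0 : 0 <= sup S by apply: sup_upper_bound.
have s1 : sup S <= 1 by apply: ge_sup; [exists 0|move=> t [/andP[]]].
have [r [Fr rs]] := cover _ s0 s1.
have /(@cg (sup S))/nbhs_ballP[d /= d0 dr] := reach_near rs.
have [t [/andP[t0 t1] pt] st'] := sup_adherent d0 supS.
have pr : p = r.
  apply: (uniq t) => //; apply: dr; rewrite -ball_normE /= ger0_norm.
    by rewrite ltrBlDl addrC -ltrBlDl.
  by rewrite subr_ge0; apply: sup_upper_bound => //; split=> //; rewrite t0.
have [sS|sS] := eqVneq (sup S) 1.
  apply/esym; apply: (reach_well_eq e0 (x := q)) => //; last exact: well_zero.
  by move: rs; rewrite pr sS /g scale1r addrC subrK.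
have {}s1 : sup S < 1 by rewrite lt_neqAle sS.
pose h := Num.min (d / 2) (1 - sup S).
have h0 : 0 < h by rewrite lt_min divr_gt0// subr_gt0.
have hd : h < d by rewrite gt_min ltr_pdivrMr// ltr_pMr// ltr1n.
have h1 : h <= 1 - sup S by rewrite ge_min lexx orbT.
have : S (sup S + h).
  split; first by rewrite addr_ge0 ?(ltW h0)//= -lerBrDl.
  rewrite pr; apply: dr; rewrite -ball_normE /= opprD addrA subrr sub0r normrN.
  by rewrite gtr0_norm.
by move=> /(sup_upper_bound supS); rewrite gerDl leNgt h0.
Qed.

End basins.

(** * Positive extended reals *)

Lemma le_inve_of_lt {R : realType} (L x : \bar R) : (0 < x)%E ->
  (forall c : R, 0 < c -> (c%:E < x)%E -> (L <= (c^-1)%:E)%E) ->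
  (L <= x^-1)%E.
Proof.
move=> x0 Lc; apply/lee_addgt0Pr => e e0; case: x x0 Lc => [x| |] //.
  rewrite lte_fin => x0 Lc; rewrite inver gt_eqF// -EFinD -[x^-1 + e]invrK.
  have xe0 : 0 < x^-1 + e by rewrite addr_gt0// invr_gt0.
  apply: Lc; first by rewrite invr_gt0.
  by rewrite lte_fin -[ltRHS]invrK ltf_pV2 ?posrE ?invr_gt0// ltrDl.
by move=> _ Lc; rewrite invey add0e -[e]invrK; apply: Lc; rewrite ?invr_gt0// ltry.
Qed.

Lemma pos_real_lt {R : realType} (x : \bar R) : (0 < x)%E ->
  exists2 c : R, 0 < c & (c%:E < x)%E.
Proof.
case: x => [x| |] //; last by exists 1; rewrite ?ltry.
rewrite lte_fin => x0; exists (x / 2); first exact: divr_gt0.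
by rewrite lte_fin ltr_pdivrMr// ltr_pMr// ltr1n.
Qed.

(** * The global inverse *)

Section global_inverse.
Context {R : realType} {X Y : completeNormedModType R}.
Variables (f : X -> Y) (Jf : X -> set (X -> Y)).
Hypothesis Jpseudo : pseudo_jacobian f Jf.
Hypothesis Jreg : forall x, regular_at Jf x.
Hypothesis chain : strong_chain_rule f Jf.
Hypothesis PS : forall y : Y, exists2 h : R -> R,
  weight h & weighted_chang_PS (dist_fun f y) h.

Let lF y : locally_lipschitz (dist_fun f y) := dist_fun_lipschitz y chain.1.
Let cF y : continuous (dist_fun f y) := locally_lipschitz_continuous (@lF y).
Let F_ge0 y x : 0 <= dist_fun f y x.
Proof. exact: normr_ge0. Qed.

Lemma exists_sur_bound x : exists c r : R, [/\ 0 < c, 0 < r & sur_bound Jf x r c].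
Proof.
have [c c0 cx] := pos_real_lt (Jreg x).2.
by have [r r0 sb] := regular_sur_bound (Jreg x) cx; exists c, r.
Qed.

Lemma dist_fun_eq0 y x : dist_fun f y x = 0 <-> f x = y.
Proof.
split=> [/eqP|<-]; last by rewrite /dist_fun subrr normr0.
by rewrite /dist_fun normr_eq0 subr_eq0 => /eqP.
Qed.

(** Local expansion is the linear lower bound required of a well; the radius [r / 4] keeps [3 * d]
    below [r]. *)
Lemma well_dist_fun y q : f q = y -> well (dist_fun f y) q q.
Proof.
move=> <-; have [c [r [c0 r0 sb]]] := exists_sur_bound q.
exists (r / 4), c; split; rewrite ?divr_gt0//.
- move=> z zq; apply: (sur_bound_expanding Jpseudo c0 sb).
    by apply: le_lt_trans zq _; lra.
  by rewrite subrr normr0.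
- by rewrite subrr normr0 divr_gt0.
- by rewrite /dist_fun subrr normr0 mulr_gt0// divr_gt0.
Qed.

(** Each zero lies in its own well, so a point outside the open set of wells is not a zero and is
    steep by regularity; [uniform_steep] makes the rate uniform. *)
Lemma dist_fun_steep y (M : R) : exists2 e : R, 0 < e &
  forall x, dist_fun f y x <= M -> ~ in_well (dist_fun f y) x ->
    steep (dist_fun f y) e x.
Proof.
have [h wh PSy] := PS y.
apply: (uniform_steep (@lF y) (@F_ge0 y) wh PSy).
  exact: in_well_open (@cF y).
move=> x nwx; have [c [r [c0 r0 sb]]] := exists_sur_bound x.
exists (c / 2); first exact: divr_gt0.
apply: (steep_dist_fun chain sb); rewrite ?subrr ?normr0//.
- apply/eqP => yfx; apply: nwx; exists x; split; first exact/dist_fun_eq0.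
  exact: well_dist_fun.
- by rewrite divr_ge0// ltW.
- by rewrite ltr_pdivrMr// ltr_pMr// ltr1n.
Qed.

Lemma pseudo_jacobian_bij : bijective f.
Proof.
have onto y : exists x, f x = y.
  have [q /dist_fun_eq0 fq] := exists_zero (@cF y) (@F_ge0 y) (dist_fun_steep y).
  by exists q.
have [g gf] := choice onto.
exists g => // x; pose y := f x.
have wz q : dist_fun f y q = 0 -> well (dist_fun f y) q q.
  by move=> /dist_fun_eq0; exact: well_dist_fun.
apply: (unique_zero (@cF y) (@F_ge0 y) (dist_fun_steep y) wz);
  exact/dist_fun_eq0.
Qed.

Lemma pseudo_jacobian_coercive : norm_coercive f.
Proof.
move=> M; have [h wh PS0] := PS 0.
have [K FK] := PS_coercive (@lF 0) (@F_ge0 0) wh PS0 M.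
exists (K + 1) => x Kx; rewrite leNgt; apply/negP => fxM.
have := FK x; rewrite /dist_fun subr0 => /(_ (ltW fxM)); lra.
Qed.

Variable g : Y -> X.
Hypothesis fK : cancel f g.
Hypothesis gK : cancel g f.

Lemma sur_bound_inverse x0 (r c d : R) x y : sur_bound Jf x0 r c -> 0 < c ->
  `|x - x0| + d <= r -> `|f x - y| < c / 2 * d -> `|g y - x| < d.
Proof.
move=> sb c0 xd fxy; have c2 : c / 2 < c by rewrite ltr_pdivrMr// ltr_pMr// ltr1n.
have [x1 x1d <-] := sur_bound_onto chain sb (divr_gt0 c0 (ltr0Sn R 1)) c2 xd fxy.
by rewrite fK.
Qed.

Lemma inverse_continuous : continuous g.
Proof.
move=> y; apply/cvgrPdist_lt => e e0.
have [c [r [c0 r0 sb]]] := exists_sur_bound (g y).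
have d0 : 0 < Num.min e r by rewrite lt_min e0.
apply/nbhs_ballP; exists (c / 2 * Num.min e r).
  by rewrite /= mulr_gt0// divr_gt0.
move=> z; rewrite -ball_normE /= => yz; rewrite distrC.
have : `|g z - g y| < Num.min e r.
  apply: sur_bound_inverse sb c0 _ _; last by rewrite gK.
  by rewrite subrr normr0 add0r ge_min lexx orbT.
by rewrite lt_min => /andP[].
Qed.

Lemma inverse_bilipschitz : locally_bilipschitz_inv f g.
Proof.
move=> x; have [c [r [c0 r0 sb]]] := exists_sur_bound x.
have [s [L [s0 L0 fL]]] := locally_lipschitz_ball x chain.1.
pose d := Num.min r s; have d0 : 0 < d by rewrite lt_min r0.
have [dr ds] : d <= r /\ d <= s by split; rewrite ge_min lexx ?orbT.
have dist z : ball x d z -> `|z - x| < d by rewrite -ball_normE /= distrC.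
exists (ball x d); split.
- exact: ball_open.
- exact: ballxx.
- apply/lipschitz_onP; exists L => // z w /dist zd /dist wd.
  by apply: fL; [exact: lt_le_trans ds|exact: lt_le_trans ds].
- rewrite openE => _ [z /dist zd <-].
  pose k := d - `|z - x|; have k0 : 0 < k by rewrite subr_gt0.
  apply/nbhs_ballP; exists (c / 2 * k); first by rewrite /= mulr_gt0// divr_gt0.
  move=> y; rewrite -ball_normE /= => yz; exists (g y); last exact: gK.
  rewrite -ball_normE /= distrC; apply: le_lt_trans (ler_distD z _ _) _.
  have zk : `|z - x| + k <= r by rewrite /k addrC subrK.
  by have := sur_bound_inverse sb c0 zk yz; rewrite /k; lra.
- apply/lipschitz_onP; exists c^-1; first by rewrite invr_ge0 ltW.
  move=> _ _ [z /dist zd <-] [w /dist wd <-]; rewrite !fK ler_pdivlMl//.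
  by apply: (sur_bound_expanding Jpseudo c0 sb); exact: lt_le_trans dr.
Qed.

(** For each positive real [c] below the index, [g] maps a small ball around [y] into a ball where
    [f] expands distances by the factor [c], hence is Lipschitz there with constant [c^-1]. *)
Lemma Lip_at_inverse y : (Lip_at g y <= (reg_index Jf (g y))^-1)%E.
Proof.
apply: le_inve_of_lt => [|c c0 cy]; first exact: (Jreg (g y)).2.
have [r r0 sb] := regular_sur_bound (Jreg (g y)) cy.
apply: ereal_inf_le; eexists.
  by exists (c / 2 * r) => //=; rewrite mulr_gt0// divr_gt0.
apply: ge_ereal_sup => _ [->|[[p q] /= [yp yq pq] <-]].
  by rewrite lee_fin invr_ge0 ltW.
have near z : ball y (c / 2 * r) z -> `|g z - g y| < r.
  rewrite -ball_normE /= => yz; apply: sur_bound_inverse sb c0 _ _.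
    by rewrite subrr normr0 add0r.
  by rewrite gK.
rewrite lee_fin ler_pdivrMr ?normr_gt0 ?subr_eq0// mulrC ler_pdivlMr//.
rewrite mulrC -{2}[p]gK -{2}[q]gK.
by apply: (sur_bound_expanding Jpseudo c0 sb); exact: near.
Qed.

End global_inverse.

Theorem theorem18 (R : realType) (X Y : completeNormedModType R)
    (f : X -> Y) (Jf : X -> set (X -> Y))
    (f_lip : locally_lipschitz f)
    (Jf_pseudo : pseudo_jacobian f Jf)
    (Jf_reg : forall x, regular_at Jf x)
    (Jf_chain : strong_chain_rule f Jf)
    (F_PS : forall y : Y, exists2 h : R -> R,
       weight h & weighted_chang_PS (dist_fun f y) h) :
  exists g : Y -> X,
    [/\ homeomorphism_inv f g,
        locally_bilipschitz_inv f g,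
        norm_coercive f &
        forall y : Y, (Lip_at g y <= (reg_index Jf (g y))^-1)%E].
Proof.
have [g fK gK] := pseudo_jacobian_bij Jf_pseudo Jf_reg Jf_chain F_PS.
exists g; split.
- split=> //; first exact: locally_lipschitz_continuous.
  exact: (@inverse_continuous _ _ _ f Jf).
- exact: (@inverse_bilipschitz _ _ _ f Jf).
- exact: (@pseudo_jacobian_coercive _ _ _ f Jf).
- exact: (@Lip_at_inverse _ _ _ f Jf).
Qed.
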